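(* Any nonconstant real harmonic function $a(u)$, $u=(u^1,u^2)$, defines a pair of almost compatible metrics $g_1^{ij}(u)=\exp(a(u))\,\delta^{ij}$, $1\le i,j\le2$, and $g_2^{ij}(u)=\delta^{ij}$, $1\le i,j\le2$, which are not compatible. For a complex-valued harmonic function $a(u)$, these metrics are compatible if and only if $a=a(u^1\pm i\,u^2)$, that is, $a$ is a function of $u^1+i\,u^2$ alone or a function of $u^1-i\,u^2$ alone.
   Context: Here $i$ in $u^1\pm i\,u^2$ is the imaginary unit; $a$ is harmonic if $\frac{\partial^2a}{\partial(u^1)^2}+\frac{\partial^2a}{\partial(u^2)^2}=0$. Functions are considered on a connected domain. Metrics are contravariant (upper indices; complex-valued if $a$ is complex-valued), $g_{ij}$ denotes the inverse of $g^{ij}$; $\Gamma^i_{jk}$ are the Levi--Civita connection coefficients, $\Gamma^{ij}_k=g^{is}\Gamma^j_{sk}$, and $$R^i_{jkl}=-\frac{\partial\Gamma^i_{jl}}{\partial u^k}+\frac{\partial\Gamma^i_{jk}}{\partial u^l}-\Gamma^i_{pk}\Gamma^p_{jl}+\Gamma^i_{pl}\Gamma^p_{jk},\qquad R^{ij}_{kl}=g^{is}R^j_{skl}.$$ The subscripts $1,2$ on $\Gamma$ and $R$ refer to $g_1^{ij}$, $g_2^{ij}$; objects without subscript refer to $g^{ij}=\lambda_1g_1^{ij}+\lambda_2g_2^{ij}$. The metrics are called almost compatible if for all constants $\lambda_1,\lambda_2$ with $\det(\lambda_1g_1^{ij}+\lambda_2g_2^{ij})\not\equiv0$ one has $\Gamma^{ij}_k=\lambda_1\Gamma^{ij}_{1,k}+\lambda_2\Gamma^{ij}_{2,k}$,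 and compatible if for all such $\lambda_1,\lambda_2$ one has in addition $R^{ij}_{kl}=\lambda_1R^{ij}_{1,kl}+\lambda_2R^{ij}_{2,kl}$. *)

(* Defs.v *)
From HB Require Import structures.
From mathcomp Require Import all_boot all_order all_algebra.
From mathcomp Require Import complex.
From mathcomp Require Import all_classical all_reals all_analysis.

Set Implicit Arguments.
Unset Strict Implicit.
Unset Printing Implicit Defensive.

Import Order.TTheory GRing.Theory Num.Theory.
Import numFieldNormedType.Exports.
Local Open Scope classical_set_scope.
Local Open Scope ring_scope.
Local Open Scope complex_scope.

Definition is_domain (R : realType) (n : nat) (D : set 'rV[R]_n) : Prop :=
  [/\ D !=set0, open D & connected D].

Definition nonconstant (T U : Type) (D : set T) (f : T -> U) : Prop :=
  exists x y, [/\ D x, D y & f x <> f y].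

Section RealCalculus.
Variables (R : realType) (n : nat).
Implicit Types (f : 'rV[R]_n -> R) (D : set 'rV[R]_n).

Definition pderiv (i : 'I_n) f : 'rV[R]_n -> R := fun u => 'D_('e_i) f u.

Definition C1 D f : Prop := forall u, D u -> forall i : 'I_n,
  derivable f u ('e_i) /\ {for u, continuous (pderiv i f)}.

Definition C2 D f : Prop := C1 D f /\ forall i, C1 D (pderiv i f).

End RealCalculus.

(* Complex-valued functions of real variables are differentiated through
   their real and imaginary parts: R[i] carries no topological R-module
   structure in the library. *)
Section ComplexCalculus.
Variables (R : realType) (n : nat).
Implicit Types (f : 'rV[R]_n -> R[i]) (D : set 'rV[R]_n).

Definition cpderiv (i : 'I_n) f : 'rV[R]_n -> R[i] := fun u =>
  pderiv i (fun v => complex.Re (f v)) u +i* pderiv i (fun v => complex.Im (f v)) u.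

Definition cC2 D f : Prop :=
  C2 D (fun v => complex.Re (f v)) /\ C2 D (fun v => complex.Im (f v)).

Definition cexp (z : R[i]) : R[i] :=
  (expR (complex.Re z))%:C * (cos (complex.Im z) +i* sin (complex.Im z)).

Definition holomorphic_on (S : set R[i]) (F : R[i] -> R[i]) : Prop :=
  forall z, S z -> derivable (F : R[i]^o -> R[i]^o) z 1.

End ComplexCalculus.

(* [K] is the field of values (R or R[i]), [pd i] the partial derivative with
   respect to the i-th coordinate, and [reg] the C^2 functions on [D].  All
   metrics are contravariant: [g u] is the matrix of the g^{ij}(u).
   Upper indices come before lower ones: [christoffel g i j k] is
   Gamma^i_{jk}, [gamma_up g i j k] is Gamma^{ij}_k, [riemann g i j k l] is
   R^i_{jkl} and [riemann_up g i j k l] is R^{ij}_{kl}. *)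
Section Geometry.
Variables (R : realType) (n : nat) (K : fieldType).
Local Notation scalar := ('rV[R]_n -> K).
Local Notation tensor := ('rV[R]_n -> 'M[K]_n).
Variable pd : 'I_n -> scalar -> scalar.
Implicit Types (g : tensor) (D : set 'rV[R]_n) (i j k l p s : 'I_n).

Definition harmonic_on (reg : scalar -> Prop) D (a : scalar) : Prop :=
  reg a /\ forall u, D u -> \sum_i pd i (pd i a) u = 0.

Definition is_metric (reg : scalar -> Prop) D g : Prop :=
  (forall i j, reg (fun u => g u i j)) /\
  forall u, D u -> (g u)^T = g u /\ \det (g u) != 0.

Definition covariant g : tensor := fun u => invmx (g u).

Definition christoffel g i j k : scalar := fun u =>
  2%:R^-1 * \sum_s g u i s *
    (pd j (fun v => covariant g v s k) u + pd k (fun v => covariant g v j s) u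
     - pd s (fun v => covariant g v j k) u).

Definition gamma_up g i j k : scalar := fun u =>
  \sum_s g u i s * christoffel g j s k u.

Definition riemann g i j k l : scalar := fun u =>
  - pd k (christoffel g i j l) u + pd l (christoffel g i j k) u
  - (\sum_p christoffel g i p k u * christoffel g p j l u)
  + (\sum_p christoffel g i p l u * christoffel g p j k u).

Definition riemann_up g i j k l : scalar := fun u =>
  \sum_s g u i s * riemann g j s k l u.

Definition pencil (l1 l2 : K) (g1 g2 : tensor) : tensor :=
  fun u => l1 *: g1 u + l2 *: g2 u.

Definition admissible D (g1 g2 : tensor) (l1 l2 : K) : Prop :=
  exists2 u, D u & \det (pencil l1 l2 g1 g2 u) != 0.

(* The objects of the pencil are defined only where its determinant does not
   vanish, and det <> 0 as a function does not exclude zeros; so the identities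
   below are required at the points of [D] where the determinant is nonzero. *)
Definition almost_compatible D (g1 g2 : tensor) : Prop :=
  forall l1 l2 : K, admissible D g1 g2 l1 l2 ->
  forall u, D u -> \det (pencil l1 l2 g1 g2 u) != 0 ->
  forall i j k, gamma_up (pencil l1 l2 g1 g2) i j k u =
    l1 * gamma_up g1 i j k u + l2 * gamma_up g2 i j k u.

Definition compatible D (g1 g2 : tensor) : Prop :=
  almost_compatible D g1 g2 /\
  forall l1 l2 : K, admissible D g1 g2 l1 l2 ->
  forall u, D u -> \det (pencil l1 l2 g1 g2 u) != 0 ->
  forall i j k l, riemann_up (pencil l1 l2 g1 g2) i j k l u =
    l1 * riemann_up g1 i j k l u + l2 * riemann_up g2 i j k l u.

End Geometry.

Section Plane.
Variable R : realType.

Definition zcoord (u : 'rV[R]_2) : R[i] := u 0 0 +i* u 0 1.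
Definition zbarcoord (u : 'rV[R]_2) : R[i] := u 0 0 -i* u 0 1.

(* With real u^1, u^2 every function of u is set-theoretically a function of
   u^1 + i u^2; "a = a(u^1 + i u^2)" means a function of the complex variable
   u^1 + i u^2 in the sense of complex analysis, i.e. a holomorphic one. *)
Definition function_of (w : 'rV[R]_2 -> R[i]) (D : set 'rV[R]_2)
    (a : 'rV[R]_2 -> R[i]) : Prop :=
  exists2 F : R[i] -> R[i], holomorphic_on (w @` D) F &
    forall u, D u -> a u = F (w u).

End Plane.

(* Main.v *)
Require Import Defs.
From mathcomp Require Import all_boot all_order all_algebra.
From mathcomp Require Import complex.
From mathcomp Require Import all_classical all_reals all_analysis.
From mathcomp Require Import ring lra.

(** The metrics g_1, g_2 and all members F delta^ij of their pencil, with
   F = lambda_1 exp a + lambda_2, are conformally flat.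

   The symbols Gamma^ij_k of F delta^ij are linear in the first derivatives of F
   ([gamma_up_conformal]), so the pencil is almost compatible for every function
   a.  The curvature R^ij_kl of F delta^ij is the Gaussian curvature times a
   constant tensor, and the Gaussian curvature is F / 2 times the Laplacian of
   log F ([riemann_up_conformal]).  For harmonic a it equals

     lambda_1 lambda_2 exp(a) (a_1 ^ 2 + a_2 ^ 2) / (2 F),

   where a_1, a_2 are the partial derivatives of a.  It is zero for g_1 and for
   g_2, so the metrics are compatible exactly when a_1 ^ 2 + a_2 ^ 2 = 0 on the
   domain ([conformal_pencil_compatible]).

   For real a this says that the gradient vanishes, that is, that a is constant.
   For complex a it says that (a_1 - i a_2) (a_1 + i a_2) = 0.  As a is harmonic,
   the first factor is holomorphic and the second antiholomorphic, so on a
   connected domain one of them vanishes identically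
   ([harmonic_gradient_dichotomy]).  The equations a_2 = i a_1 and a_2 = - i a_1
   are the Cauchy-Riemann equations for a as a holomorphic function of
   u^1 + i u^2 and of u^1 - i u^2 ([function_of_cpderiv],
   [cauchy_riemann_function_of]).

   The analytic ingredient is unique continuation for holomorphic functions, and
   it is obtained without integration.  If f is holomorphic with uniformly small
   Taylor remainders on a disc, the average of f over the n-th roots of unity on
   a circle depends on the radius only up to an error that vanishes as n grows,
   because its radial derivative is, up to a factor, a telescoping sum of
   increments of f around the polygon.  Hence |f z0| is at most the maximum of
   |f| on any circle with centre z0 ([mean_value_le]).  If moreover f vanishes
   near c, then f / (z - c) ^ k is again holomorphic, and applying the inequality
   to it for all k forces f z0 = 0 as soon as the disc of radius 2 |z0 - c|
   around z0, and a little more, lies in the domain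
   ([flat_holomorphic_vanish]).  Thus the interior of the zero set is open and
   relatively closed ([cauchy_riemann_unique_continuation]). *)

Set Implicit Arguments.
Unset Strict Implicit.
Unset Printing Implicit Defensive.
Import Order.TTheory GRing.Theory Num.Theory.
Import numFieldNormedType.Exports.
Local Open Scope classical_set_scope.
Local Open Scope ring_scope.
Local Open Scope complex_scope.

(** * Directional derivatives and C2 functions *)

Lemma dist_le_halves (R : realFieldType) (a b c e : R) :
  `|a - c| < e / 2 -> `|a - b| < e / 2 -> `|b - c| <= e.
Proof. rewrite !ltr_norml ler_norml; lra. Qed.

Lemma mulf2_inj (R : fieldType) (h A B p q : R) :
  h != 0 -> p = h * (h * A) -> q = h * (h * B) -> p = q -> A = B.
Proof. by move=> h0 -> -> /(mulfI h0)/(mulfI h0). Qed.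

Section DirectionalDerivatives.
Variables (R : realType) (n : nat).
Implicit Types (f g : 'rV[R]_n -> R) (u v x : 'rV[R]_n) (D : set 'rV[R]_n).

Lemma is_derive_line f x v (t : R) : derivable f (t *: v + x) v ->
  is_derive t (1 : R) (fun s : R => f (s *: v + x)) ('D_v f (t *: v + x)).
Proof.
have E : (fun h : R => h^-1 *: (((fun s : R => f (s *: v + x)) \o shift t) (h *: (1 : R))
    - f (t *: v + x))) = (fun h => h^-1 *: ((f \o shift (t *: v + x)) (h *: v)
    - f (t *: v + x))).
  apply/funext => h /=; congr (_ *: (f _ - _)).
  by rewrite [h *: 1]mulr1 scalerDl addrA.
by move=> df; split; [rewrite /derivable E | rewrite /derive E].
Qed.

(** Parametrizing the segment by [0, 1] treats both signs of h at once. *)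
Lemma mvt_line f x v (h : R) :
  (forall s : R, 0 <= s <= 1 -> derivable f ((s * h) *: v + x) v) ->
  exists2 s : R, 0 <= s <= 1 &
    f (h *: v + x) - f x = h * 'D_v f ((s * h) *: v + x).
Proof.
move=> df.
pose phi := (fun t : R => f (t *: v + x)) \o (fun s : R => s * h).
have dphi (s : R) : 0 <= s <= 1 ->
    is_derive s (1 : R) phi (h * 'D_v f ((s * h) *: v + x)).
  move=> hs; have d1 := is_derive_line (df s hs).
  have d2 : is_derive s (1 : R) (fun s : R => s * h) h.
    have : is_derive s (1 : R) ((id : R -> R) * cst h) (s *: 0 + h *: 1).
      exact: is_deriveM.
    by rewrite scaler0 add0r [h *: 1]mulr1.
  by rewrite mulrC; exact: is_derive1_comp.
have [|||s hs] := @MVT_segment R phi (fun s => h * 'D_v f ((s * h) *: v + x)) 0 1.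
- exact: ler01.
- by move=> s; rewrite in_itv /= => /andP[s0 s1]; apply: dphi; rewrite !ltW.
- apply: derivable_within_continuous => s; rewrite in_itv /= => hs.
  exact: (@ex_derive _ _ _ _ _ _ _ (dphi s hs)).
rewrite /phi /= mul1r mul0r scale0r add0r subr0 mulr1 => ->.
by exists s => //; move: hs; rewrite in_itv.
Qed.

Lemma pderiv_near f g u i : (\near u, f u = g u) -> pderiv i f u = pderiv i g u.
Proof. by move=> fg; exact: near_eq_derive. Qed.

Lemma C1_derivable D f u i : C1 D f -> D u -> derivable f u 'e_i.
Proof. by move=> df Du; have [] := df u Du i. Qed.

Lemma near_open D u (P : 'rV[R]_n -> Prop) :
  open D -> D u -> (forall v, D v -> P v) -> \forall v \near u, P v.
Proof.
move=> oD Du DP; have nD : nbhs u D by exact: open_nbhs_nbhs.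
by apply: filterS nD.
Qed.

Lemma C1_eq D f g : open D -> (forall u, D u -> f u = g u) -> C1 D f -> C1 D g.
Proof.
move=> oD fg df u Du i; have [d c] := df u Du i.
have nfg v : D v -> \near v, f v = g v by move=> Dv; exact: near_open oD Dv fg.
split; first exact: near_eq_derivable (nfg u Du) d.
have e v : D v -> pderiv i f v = pderiv i g v by move=> Dv; apply: pderiv_near; exact: nfg.
rewrite /prop_for /continuous_at -(e u Du).
apply: cvg_trans c; exact: (near_eq_cvg (near_open oD Du e)).
Qed.

Lemma C1_cst D (c : R) : C1 D (fun=> c).
Proof.
move=> u Du i; split; first exact: derivable_cst.
have -> : pderiv i (fun=> c) = cst 0 by apply/funext => x; exact: derive_cst.
exact: cst_continuous.
Qed.

Lemma pderivD f g u i : derivable f u 'e_i -> derivable g u 'e_i ->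
  pderiv i (fun v => f v + g v) u = pderiv i f u + pderiv i g u.
Proof. by move=> df dg; exact: deriveD. Qed.

Lemma pderivN f u i : derivable f u 'e_i ->
  pderiv i (fun v => - f v) u = - pderiv i f u.
Proof. by move=> df; exact: deriveN. Qed.

Lemma pderivM f g u i : derivable f u 'e_i -> derivable g u 'e_i ->
  pderiv i (fun v => f v * g v) u = f u * pderiv i g u + pderiv i f u * g u.
Proof.
move=> df dg; have := deriveM df dg.
by rewrite /pderiv [g u *: _]mulrC.
Qed.

Lemma pderivV f u i : f u != 0 -> derivable f u 'e_i ->
  pderiv i (fun v => (f v)^-1) u = - (f u) ^- 2 * pderiv i f u.
Proof. by move=> f0 df; exact: deriveV. Qed.

Lemma pderiv_cst (c : R) u i : pderiv i (fun=> c) u = 0.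
Proof. exact: derive_cst. Qed.

Lemma is_derive_comp_dir (phi dphi : R -> R) f u v :
  (forall t, is_derive t (1 : R) phi (dphi t)) -> derivable f u v ->
  is_derive u v (phi \o f) (dphi (f u) * 'D_v f u).
Proof.
move=> hphi df.
have d1 : is_derive (0 : R) (1 : R) (fun s : R => f (s *: v + u)) ('D_v f u).
  have := @is_derive_line f u v 0; rewrite scale0r add0r => H; exact: H.
have d2 : is_derive (0 : R) (1 : R) (phi \o (fun s : R => f (s *: v + u)))
    (dphi (f u) * 'D_v f u).
  apply: is_derive1_comp; rewrite scale0r add0r; exact: hphi.
have E : (fun h : R => h^-1 *: (((phi \o (fun s : R => f (s *: v + u))) \o shift 0)
   (h *: (1 : R)) - (phi \o (fun s : R => f (s *: v + u))) 0)) =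
   (fun h => h^-1 *: (((phi \o f) \o shift u) (h *: v) - (phi \o f) u)).
  by apply/funext => h /=; rewrite [h *: 1]mulr1 addr0 scale0r add0r.
case: d2; rewrite /derivable /derive E => a b; split => //.
Qed.


Lemma C1_near D f u (e : R) i : open D -> C1 D f -> D u -> 0 < e ->
  \forall v \near u, D v /\ `|pderiv i f v - pderiv i f u| < e.
Proof.
move=> oD df Du e0; have nD : nbhs u D by exact: open_nbhs_nbhs.
have [_ /cvgrPdist_lt/(_ e e0) c] := df u Du i.
by apply: filterS (filterI nD c) => v []; rewrite distrC.
Qed.

Lemma is_derive_translate f w u v df : is_derive (w + u) v f df ->
  is_derive u v (fun x => f (w + x)) df.
Proof.
have E : (fun h : R => h^-1 *: ((f \o shift (w + u)) (h *: v) - f (w + u))) =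
    (fun h => h^-1 *: (((fun x => f (w + x)) \o shift u) (h *: v) - f (w + u))).
  by apply/funext => h /=; rewrite addrCA.
by case; rewrite /derivable /derive E.
Qed.

Lemma norm_delta_le i (h : R) : `|h *: ('e_i : 'rV[R]_n)| <= `|h|.
Proof.
rewrite normrZ -[leRHS]mulr1 ler_wpM2l// /Num.norm/= mx_normrE.
apply/bigmax_leP; split=> // -[a b] _ /=; rewrite mxE.
by case: (_ && _); rewrite ?normr0 ?normr1.
Qed.

Lemma derive_lineD f w u v (s h : R) : derivable f (w + ((s * h) *: v + u)) v ->
  derivable f ((s * h) *: v + u) v ->
  is_derive ((s * h) *: v + u) v (fun x => f (w + x) - f x)
    ('D_v f (w + ((s * h) *: v + u)) - 'D_v f ((s * h) *: v + u)).
Proof.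
move=> d1 d2.
have h1 := is_derive_translate (derivableP d1).
have h2 := derivableP d2.
exact: is_deriveB.
Qed.

(** The second difference of f over a small parallelogram, as a mixed
   derivative at an interior point: the mean value theorem is applied to the
   first difference of f along e_i, and then to its derivative along e_j. *)
Lemma second_difference D f u i j (h : R) :
  C2 D f ->
  (forall s t : R, 0 <= s <= 1 -> 0 <= t <= 1 ->
     D ((s * h) *: 'e_i + (t * h) *: 'e_j + u)) ->
  exists s t : R, [/\ 0 <= s <= 1, 0 <= t <= 1 &
    f (h *: 'e_i + (h *: 'e_j + u)) - f (h *: 'e_j + u) - f (h *: 'e_i + u) + f u =
    h * (h * pderiv i (pderiv j f) ((s * h) *: 'e_i + (t * h) *: 'e_j + u))].
Proof.
move=> [df d2f] hD.
have h01 : 0 <= (1 : R) <= 1 by apply/andP; split.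
have h00 : 0 <= (0 : R) <= 1 by apply/andP; split.
have De t : 0 <= t <= 1 -> D ((t * h) *: 'e_j + u).
  by move=> ht; have := hD 0 t h00 ht; rewrite mul0r scale0r add0r.
have De' t : 0 <= t <= 1 -> D (h *: 'e_i + ((t * h) *: 'e_j + u)).
  by move=> ht; have := hD 1 t h01 ht; rewrite mul1r addrA.
have dphi t : 0 <= t <= 1 -> is_derive ((t * h) *: 'e_j + u) 'e_j
    (fun x => f (h *: 'e_i + x) - f x)
    (pderiv j f (h *: 'e_i + ((t * h) *: 'e_j + u)) - pderiv j f ((t * h) *: 'e_j + u)).
  move=> ht; apply: derive_lineD; apply: C1_derivable df _; [exact: De'|exact: De].
have [|t ht E] := @mvt_line (fun x => f (h *: 'e_i + x) - f x) u 'e_j h.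
  by move=> t ht; exact: (@ex_derive _ _ _ _ _ _ _ (dphi t ht)).
have [|s hs E'] := @mvt_line (pderiv j f) ((t * h) *: 'e_j + u) 'e_i h.
  move=> s hs; apply: C1_derivable (d2f j) _.
  by rewrite addrA; exact: hD.
exists s, t; split=> //.
have -> : f (h *: 'e_i + (h *: 'e_j + u)) - f (h *: 'e_j + u) - f (h *: 'e_i + u) + f u =
  f (h *: 'e_i + (h *: 'e_j + u)) - f (h *: 'e_j + u) - (f (h *: 'e_i + u) - f u) by ring.
rewrite E (@derive_val _ _ _ _ _ _ _ (dphi t ht)).
by rewrite E' addrA.
Qed.

(** Symmetry of second derivatives: the two mixed derivatives, each at some
   point close to u, equal one and the same second difference quotient, and both
   are continuous at u. *)
Lemma schwarz D f u i j : open D -> C2 D f -> D u ->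
  pderiv i (pderiv j f) u = pderiv j (pderiv i f) u.
Proof.
move=> oD c2 Du; apply/eqP; rewrite -subr_eq0 -normr_le0.
apply/ler_addgt0Pl => e e0; rewrite addr0.
have e2 : 0 < e / 2 by rewrite divr_gt0.
have /nbhs_ballP[d /= d0 hd] : \forall v \near u, 
   (D v /\ `|pderiv i (pderiv j f) v - pderiv i (pderiv j f) u| < e / 2) /\
   (D v /\ `|pderiv j (pderiv i f) v - pderiv j (pderiv i f) u| < e / 2).
  by apply: filterI; apply: C1_near => //; exact: c2.2.
pose h := d / 4.
have h0 : 0 < h by rewrite divr_gt0.
have hb a b (s t : R) : 0 <= s <= 1 -> 0 <= t <= 1 ->
    ball u d ((s * h) *: 'e_a + (t * h) *: 'e_b + u).
  move=> /andP[s0 s1] /andP[t0 t1]; rewrite -ball_normE /ball_/= opprD addrCA subrr addr0 normrN.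
  apply: le_lt_trans (ler_normD _ _) _.
  have := norm_delta_le a (s * h); have := norm_delta_le b (t * h).
  rewrite !ger0_norm ?mulr_ge0 ?(ltW h0) ?(ltW d0)//.
  have : s * h <= h by rewrite ler_piMl// ltW.
  have : t * h <= h by rewrite ler_piMl// ltW.
  have : h + h < d by rewrite /h; lra.
  lra.
have [|s [t [hs ht E1]]] := @second_difference D f u i j h c2.
  by move=> s t hs ht; have [[]] := hd _ (hb i j s t hs ht).
have [|s' [t' [hs' ht' E2]]] := @second_difference D f u j i h c2.
  by move=> s' t' hs' ht'; have [[]] := hd _ (hb j i s' t' hs' ht').
have E : pderiv i (pderiv j f) ((s * h) *: 'e_i + (t * h) *: 'e_j + u) =
    pderiv j (pderiv i f) ((s' * h) *: 'e_j + (t' * h) *: 'e_i + u).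
  apply: (mulf2_inj (lt0r_neq0 h0) E1 E2).
  have -> : f (h *: 'e_i + (h *: 'e_j + u)) = f (h *: 'e_j + (h *: 'e_i + u)).
    by congr f; exact: addrCA.
  by congr (_ + _); exact: addrAC.
have [[_ +] _] := hd _ (hb i j s t hs ht).
have [_ [_ +]] := hd _ (hb j i s' t' hs' ht').
by rewrite E; exact: dist_le_halves.
Qed.

End DirectionalDerivatives.

(** * The mean value theorem and strict differentiability in the plane *)

Lemma ord2_ind (P : 'I_2 -> Prop) : P 0 -> P 1 -> forall j, P j.
Proof.
move=> P0 P1 [[|[|//]] p].
  by rewrite (_ : Ordinal p = 0) //; exact: val_inj.
by rewrite (_ : Ordinal p = 1) //; exact: val_inj.
Qed.

Lemma big_ord2 (V : nmodType) (F : 'I_2 -> V) : \sum_i F i = F 0 + F 1.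
Proof.
by rewrite !big_ord_recl big_ord0 addr0 (_ : lift ord0 ord0 = 1)//; exact: val_inj.
Qed.

Lemma dist_le_quarters (R : realFieldType) (a b c e : R) :
  `|a - c| < e / 4 -> `|b - c| < e / 4 -> `|a - b| <= e / 2.
Proof. rewrite !ltr_norml ler_norml; lra. Qed.

Section PlaneCalculus.
Variables (R : realType).
Implicit Types (f g : 'rV[R]_2 -> R) (u v x : 'rV[R]_2) (D : set 'rV[R]_2).

Lemma norm_rV2_le x (e : R) : (`|x| <= e) = (`|x 0 0| <= e) && (`|x 0 1| <= e).
Proof.
have E0 : 0 <= `|x 0 0| by [].
apply/idP/andP => [|[h0 h1]]; rewrite {1}/Num.norm/= mx_normrE.
  by move=> /bigmax_leP[_ h]; split; [exact: (h (0, 0))|exact: (h (0, 1))].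
apply/bigmax_leP; split; first exact: le_trans h0.
by move=> [i j] _ /=; rewrite ord1; elim/ord2_ind: j.
Qed.

Lemma norm_rV2_lt x (e : R) : (`|x| < e) = (`|x 0 0| < e) && (`|x 0 1| < e).
Proof.
apply/idP/andP => [h|[h0 h1]].
  by have := lexx `|x|; rewrite {1}norm_rV2_le => /andP[a b]; split; exact: le_lt_trans h.
have : `|x| <= Num.max `|x 0 0| `|x 0 1|.
  by rewrite norm_rV2_le !le_max !lexx orbT.
by move/le_lt_trans; apply; rewrite gt_max h0 h1.
Qed.

Lemma segment_dist (a b c s d : R) : 0 <= s <= 1 ->
  `|a - c| < d -> `|b - c| < d -> `|s * (b - a) + (a - c)| < d.
Proof.
move=> /andP[s0 s1] ha hb.
have -> : s * (b - a) + (a - c) = (1 - s) * (a - c) + s * (b - c) by ring.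
have [m [md ma mb]] : exists m, [/\ m < d, `|a - c| <= m & `|b - c| <= m].
  by exists (Num.max `|a - c| `|b - c|); rewrite gt_max ha hb !le_max !lexx orbT.
apply: le_lt_trans md; apply: le_trans (ler_normD _ _) _.
have r0 : 0 <= 1 - s by rewrite subr_ge0.
rewrite !normrM (ger0_norm s0) (ger0_norm r0).
have -> : m = (1 - s) * m + s * m by ring.
by apply: lerD; apply: ler_wpM2l.
Qed.

(** The mean value theorem in the plane, along a path made of two segments
   parallel to the axes. *)
Lemma mvt_plane f u (d : R) x y :
  `|x - u| < d -> `|y - u| < d ->
  (forall v, `|v - u| < d -> forall i, derivable f v 'e_i) ->
  exists p q, [/\ `|p - u| < d, `|q - u| < d &
    f y - f x = pderiv 0 f p * (y 0 0 - x 0 0) + pderiv 1 f q * (y 0 1 - x 0 1)].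
Proof.
move=> hx hy df.
have E : y = (y 0 1 - x 0 1) *: 'e_1 + ((y 0 0 - x 0 0) *: 'e_0 + x).
  by apply/rowP; elim/ord2_ind; rewrite !mxE /=; ring.
set k := y 0 1 - x 0 1 in E *; set h := y 0 0 - x 0 0 in E *.
move: hx hy; rewrite !norm_rV2_lt !mxE => /andP[x0 x1] /andP[y0 y1].
have s1 s : 0 <= s <= 1 -> `|(s * h) *: 'e_0 + x - u| < d.
  move=> hs; rewrite norm_rV2_lt !mxE /= mulr1 mulr0 add0r x1 andbT -addrA.
  exact: segment_dist.
have s2 s : 0 <= s <= 1 -> `|(s * k) *: 'e_1 + (h *: 'e_0 + x) - u| < d.
  move=> hs; rewrite norm_rV2_lt !mxE /= !mulr1 !mulr0 !add0r -addrA.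
  rewrite segment_dist// andbT.
  by rewrite /h subrK.
have [|s hs E1] := @mvt_line _ _ f x 'e_0 h.
  by move=> s hs; exact/df/s1.
have [|t ht E2] := @mvt_line _ _ f (h *: 'e_0 + x) 'e_1 k.
  by move=> t ht; exact/df/s2.
exists ((s * h) *: 'e_0 + x), ((t * k) *: 'e_1 + (h *: 'e_0 + x)).
split; [exact: s1|exact: s2|].
have -> : f y - f x =
  (f (k *: 'e_1 + (h *: 'e_0 + x)) - f (h *: 'e_0 + x)) + (f (h *: 'e_0 + x) - f x).
  by rewrite -E subrKA.
by rewrite E1 E2 addrC /pderiv; congr (_ + _); exact: mulrC.
Qed.

(** Strict differentiability: the error term is uniform in both end points near
   u, which is what the compactness argument of [C1_uniform] needs. *)
Lemma C1_strict D f u (eta : R) : open D -> C1 D f -> D u -> 0 < eta ->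
  exists2 d : R, 0 < d & forall x y, `|x - u| < d -> `|y - u| < d ->
   D x /\ `|f y - f x - (pderiv 0 f x * (y 0 0 - x 0 0) + pderiv 1 f x * (y 0 1 - x 0 1))|
   <= eta * `|y - x|.
Proof.
move=> oD df Du e0.
have e4 : 0 < eta / 4 by rewrite divr_gt0.
have /nbhs_ballP[d /= d0 hd] : \forall v \near u, 
   (D v /\ `|pderiv 0 f v - pderiv 0 f u| < eta / 4) /\
   (D v /\ `|pderiv 1 f v - pderiv 1 f u| < eta / 4).
  by apply: filterI; apply: C1_near.
have hB v : `|v - u| < d -> ball u d v by rewrite -ball_normE /ball_/= distrC.
exists d => // x y hx hy.
split; first by have [[]] := hd _ (hB _ hx).
have [|p [q [hp hq ->]]] := @mvt_plane f u d x y hx hy.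
  by move=> v hv i; apply: C1_derivable df _; have [[]] := hd _ (hB _ hv).
have [[_ p1] _] := hd _ (hB _ hp).
have [_ [_ p2]] := hd _ (hB _ hq).
have [[_ q1] [_ q2]] := hd _ (hB _ hx).
have /andP[h1 k1] : (`|y 0 0 - x 0 0| <= `|y - x|) && (`|y 0 1 - x 0 1| <= `|y - x|).
  by have := lexx `|y - x|; rewrite {1}norm_rV2_le !mxE.
have dA := dist_le_quarters p1 q1; have dB := dist_le_quarters p2 q2.
rewrite opprD addrACA -!mulrBl.
apply: le_trans (ler_normD _ _) _; rewrite !normrM.
have -> : eta * `|y - x| = eta / 2 * `|y - x| + eta / 2 * `|y - x| by field.
exact: (lerD (ler_pM (normr_ge0 _) (normr_ge0 _) dA h1)
             (ler_pM (normr_ge0 _) (normr_ge0 _) dB k1)).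
Qed.

End PlaneCalculus.

(** * The real-valued modulus and roots of unity *)

Section ComplexNorm.
Variable R : realType.
Implicit Types (z w : R[i]) (x y : R).
Local Notation N := (@ComplexField.Normc.normc R).

Lemma normcD z w : N (z + w) <= N z + N w.
Proof. exact: (@le_normcD R z w). Qed.
Lemma normc_opp z : N (- z) = N z.
Proof. exact: (@normcN R z). Qed.
Lemma normcBC z w : N (z - w) = N (w - z).
Proof. by rewrite -normc_opp opprB. Qed.
Lemma normc_ge0 z : 0 <= N z.
Proof. by case: z => a b; exact: sqrtr_ge0. Qed.
Lemma normc_eq0 z : (N z == 0) = (z == 0).
Proof.
by apply/eqP/eqP => [/ComplexField.Normc.eq0_normc//|->]; exact: ComplexField.Normc.normc0.
Qed.
Lemma normc_gt0 z : (0 < N z) = (z != 0).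
Proof. by rewrite lt0r normc_eq0 normc_ge0 andbT. Qed.
Lemma normcX z n : N (z ^+ n) = N z ^+ n.
Proof.
elim: n => [|n IH]; first by rewrite !expr0 ComplexField.Normc.normc1.
by rewrite !exprS ComplexField.Normc.normcM IH.
Qed.
Lemma normc_real x : N x%:C = `|x|.
Proof. by rewrite /= expr0n addr0 sqrtr_sqr. Qed.
Lemma normc_natr n : N n%:R = n%:R.
Proof. by rewrite -(rmorph_nat (@real_complex R)) normc_real normr_nat. Qed.
Lemma normc_Re z : `|complex.Re z| <= N z.
Proof. by case: z => a b /=; rewrite -sqrtr_sqr ler_wsqrtr// lerDl sqr_ge0. Qed.
Lemma normc_Im z : `|complex.Im z| <= N z.
Proof. by case: z => a b /=; rewrite -sqrtr_sqr ler_wsqrtr// lerDr sqr_ge0. Qed.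
Lemma normc_le_ReIm z : N z <= `|complex.Re z| + `|complex.Im z|.
Proof.
case: z => a b /=.
rewrite -[leRHS]ger0_norm ?addr_ge0// -sqrtr_sqr ler_wsqrtr//.
rewrite -[a ^+ 2]real_normK ?num_real// -[b ^+ 2]real_normK ?num_real//.
by rewrite sqrrD lerD2r lerDl mulrn_wge0// mulr_ge0.
Qed.
Lemma normc_sum (I : Type) (r : seq I) (P : pred I) (F : I -> R[i]) :
  N (\sum_(i <- r | P i) F i) <= \sum_(i <- r | P i) N (F i).
Proof.
elim/big_ind2 : _ => [|a b c d h1 h2|//]; first by rewrite ComplexField.Normc.normc0.
by apply: le_trans (normcD _ _) _; exact: lerD.
Qed.

Lemma de_moivre (t : R) n :
  (cos t +i* sin t) ^+ n = cos (n%:R * t) +i* sin (n%:R * t).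
Proof.
elim: n => [|n IH]; first by rewrite expr0 mul0r cos0 sin0.
rewrite exprS IH -natr1 mulrDl mul1r addrC cosD sinD.
by congr (_ +i* _); rewrite [RHS]addrC //; congr (_ + _); exact: mulrC.
Qed.

(** Powers of such a root are the vertices of a closed polygon inscribed in the
   unit circle, with sides as short as desired. *)
Lemma root_unity_near1 (e : R) : 0 < e -> exists n (w : R[i]),
  [/\ (0 < n)%N, w ^+ n = 1, w != 1, N w = 1 & N (w - 1) < e].
Proof.
move=> e0.
have e2 : 0 < e / 2 by rewrite divr_gt0.
have /cvgrPdist_lt/(_ _ e2) c1 := @continuous_cos R 0.
have /cvgrPdist_lt/(_ _ e2) c2 := @continuous_sin R 0.
have /nbhs_ballP[d /= d0 hd] : \forall t \near (0 : R),
    `|cos 0 - cos t| < e / 2 /\ `|sin 0 - sin t| < e / 2 by exact: filterI.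
have p0 : 0 < pi :> R by exact: pi_gt0.
pose n := (Num.truncn (2 * pi / d)).+2.
have n0 : 0 < n%:R :> R by rewrite ltr0n.
pose t := 2 * pi / n%:R : R.
have t0 : 0 < t by rewrite divr_gt0// mulr_gt0.
have td : t < d.
  rewrite ltr_pdivrMr// (mulrC d) -ltr_pdivrMr//.
  by apply: lt_le_trans (truncnS_gt _) _; rewrite ler_nat.
have tpi : t <= pi.
  by rewrite ler_pdivrMr// (mulrC 2) ler_pM2l// ler_nat.
have [] := hd t.
  by rewrite -ball_normE /ball_/= sub0r normrN gtr0_norm.
rewrite cos0 sin0 => h1 h2.
exists n, (cos t +i* sin t); split=> //.
- rewrite de_moivre /t mulrCA divff ?gt_eqF// mulr1.
  by rewrite mulr_natl cos2pi sin2pi.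
- apply/eqP => -[ct _].
  have : t = 0.
    by apply: (@cos_inj R); rewrite ?in_itv/= ?lexx ?(ltW t0) ?(ltW p0) ?tpi ?cos0.
  by move=> E; rewrite E ltxx in t0.
- by rewrite /= cos2Dsin2 sqrtr1.
- apply: le_lt_trans (normc_le_ReIm _) _ => /=.
  move: h1 h2; rewrite distrC sub0r normrN subr0 => h1 h2.
  by rewrite (splitr e); apply: ltrD.
Qed.

End ComplexNorm.

(** * A mean value inequality without integrals *)

Section UniqueContinuation.
Variable R : realType.
Implicit Types (z w c : R[i]) (K : set R[i]) (f g : R[i] -> R[i]).
Local Notation N := (@ComplexField.Normc.normc R).
Let normcM := @ComplexField.Normc.normcM R.

(** Complex differentiability on K with a remainder uniform over pairs of points,
   so that sums of increments of f along a polygon can be estimated termwise. *)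
Definition uniformly_differentiable K f g : Prop := forall eta : R, 0 < eta ->
  exists2 d : R, 0 < d & forall z w, K z -> K w -> N (w - z) < d ->
    N (f w - f z - g z * (w - z)) <= eta * N (w - z).

Lemma normc_sum_le n (F : 'I_n -> R[i]) (b : R) :
  (forall k, N (F k) <= b) -> N (\sum_(k < n) F k) <= n%:R * b.
Proof.
move=> h; apply: le_trans (normc_sum _ _ _) _.
rewrite mulr_natl -[n in leRHS]card_ord -sumr_const.
exact: ler_sum.
Qed.

Section Circle.
Variables (K : set R[i]) (f g : R[i] -> R[i]) (z0 : R[i]) (rho eta d : R).
Hypothesis disc : forall z, N (z - z0) <= rho -> K z.
Hypothesis diff : forall z w, K z -> K w -> N (w - z) < d ->
    N (f w - f z - g z * (w - z)) <= eta * N (w - z).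
Variables (n : nat) (w : R[i]).
Hypotheses (n0 : (0 < n)%N) (wn : w ^+ n = 1) (w1 : w != 1) (Nw : N w = 1).
Hypothesis wd : rho * N (w - 1) < d.

Let ring_point (r : R) (k : nat) := z0 + r%:C * w ^+ k.
Let ring_sum (r : R) := \sum_(k < n) f (ring_point r k).

Let Nwk k : N (w ^+ k) = 1. Proof. by rewrite normcX Nw expr1n. Qed.

Let ring_norm r k : 0 <= r -> N (ring_point r k - z0) = r.
Proof.
by move=> r0; rewrite /ring_point addrC addKr normcM Nwk mulr1 normc_real ger0_norm.
Qed.

(** The weighted sum of derivatives along the circle almost vanishes because it
   is, up to a factor, a telescoping sum of increments of f around a closed
   polygon. *)
Lemma circle_derivative_sum r : 0 < r -> r <= rho ->
  N (\sum_(k < n) g (ring_point r k) * w ^+ k) <= n%:R * eta.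
Proof.
move=> r0 rr; set T := \sum_(k < n) _.
have a0 : 0 < N (r%:C * (w - 1)).
  by rewrite normc_gt0 mulf_neq0 ?subr_eq0// (inj_eq (@complexI R)) gt_eqF.
have step k : ring_point r k.+1 - ring_point r k = r%:C * (w - 1) * w ^+ k.
  by rewrite /ring_point exprS; ring.
pose E k := f (ring_point r k.+1) - f (ring_point r k)
   - g (ring_point r k) * (ring_point r k.+1 - ring_point r k).
have EE : \sum_(k < n) E k = - (r%:C * (w - 1) * T).
  rewrite /E big_split/= sumrN.
  rewrite -(big_mkord xpredT (fun k => f (ring_point r k.+1) - f (ring_point r k))).
  rewrite telescope_sumr ?leq0n// /ring_point wn expr0 subrr add0r; congr (- _).
  by rewrite /T mulr_sumr; apply: eq_bigr => k _; rewrite step mulrCA.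
rewrite -(ler_pM2l a0) -normcM -normc_opp -EE.
rewrite mulrCA; apply: normc_sum_le => k.
have Kr j : K (ring_point r j) by apply: disc; rewrite ring_norm// ltW.
have Ns : N (ring_point r k.+1 - ring_point r k) = N (r%:C * (w - 1)).
  by rewrite step normcM Nwk mulr1.
rewrite -Ns mulrC; apply: diff => //.
rewrite Ns normcM normc_real gtr0_norm//; apply: le_lt_trans wd.
by rewrite ler_wpM2r// normc_ge0.
Qed.

(** Growing the radius by h changes the sum of f over the circle by h times the
   weighted sum of derivatives bounded in [circle_derivative_sum].  Expanding f
   around the points of the larger circle, whose radius is positive, also covers
   the first step, from the centre. *)
Lemma circle_sum_step r h : 0 <= r -> 0 < h -> h < d -> r + h <= rho ->
  N (ring_sum r) <= N (ring_sum (r + h)) + n%:R * (2 * eta * h).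
Proof.
move=> r0 h0 hd rh.
have rh0 : 0 < r + h by rewrite ltr_wpDl.
set T := \sum_(k < n) g (ring_point (r + h) k) * w ^+ k.
have hT : N T <= n%:R * eta by exact: circle_derivative_sum.
have step k : ring_point r k - ring_point (r + h) k = - (h%:C * w ^+ k).
  by rewrite /ring_point rmorphD; ring.
pose E k := f (ring_point r k) - f (ring_point (r + h) k)
   - g (ring_point (r + h) k) * (ring_point r k - ring_point (r + h) k).
have -> : ring_sum r = ring_sum (r + h) + (\sum_(k < n) E k - h%:C * T).
  rewrite /ring_sum /T mulr_sumr -sumrB -big_split /=; apply: eq_bigr => k _.
  by rewrite /E step; ring.
apply: le_trans (normcD _ _) _; rewrite lerD2l.
apply: le_trans (normcD _ _) _; rewrite normc_opp.
have -> : n%:R * (2 * eta * h) = n%:R * (eta * h) + h * (n%:R * eta) by ring.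
apply: lerD.
  apply: normc_sum_le => k.
  have Ns : N (ring_point r k - ring_point (r + h) k) = h.
    by rewrite step normc_opp normcM Nwk mulr1 normc_real gtr0_norm.
  rewrite -[leRHS](congr1 (fun x => eta * x) Ns); apply: diff; rewrite ?Ns//.
    by apply: disc; rewrite ring_norm// ltW.
  by apply: disc; rewrite ring_norm//; apply: le_trans rh; rewrite lerDl ltW.
by rewrite normcM normc_real gtr0_norm// ler_wpM2l// ltW.
Qed.

Lemma circle_sum_chain h j : 0 < h -> h < d -> j%:R * h <= rho ->
  N (ring_sum 0) <= N (ring_sum (j%:R * h)) + j%:R * (n%:R * (2 * eta * h)).
Proof.
move=> h0 hd; elim: j => [|j IH] jh; first by rewrite !mul0r addr0.
have E : j.+1%:R * h = j%:R * h + h by rewrite -natr1 mulrDl mul1r.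
apply: le_trans (IH _) _.
  by apply: le_trans jh; rewrite E lerDl ltW.
have e1 (a b : R) : a + j.+1%:R * b = a + b + j%:R * b by rewrite -natr1; ring.
rewrite e1 lerD2r E; apply: circle_sum_step; rewrite -?E//.
by rewrite mulr_ge0// ltW.
Qed.

Lemma approx_mean_value B : 0 < rho -> 0 < d -> (forall z, N (z - z0) = rho -> N (f z) <= B) ->
  N (f z0) <= B + 2 * eta * rho.
Proof.
move=> rho0 d0 hB.
pose m := (Num.truncn (rho / d)).+1.
have m0 : 0 < m%:R :> R by rewrite ltr0n.
have hd : rho / m%:R < d.
  by rewrite ltr_pdivrMr// (mulrC d) -ltr_pdivrMr// truncnS_gt.
have mE : m%:R * (rho / m%:R) = rho by rewrite mulrC divfK// gt_eqF.
have := @circle_sum_chain (rho / m%:R) m (divr_gt0 rho0 m0) hd.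
rewrite mE => /(_ (lexx _)) h.
have nn : 0 < n%:R :> R by rewrite ltr0n.
rewrite -(ler_pM2l nn).
have -> : n%:R * N (f z0) = N (ring_sum 0).
  rewrite /ring_sum (eq_bigr (fun=> f z0)); last first.
    by move=> k _; rewrite /ring_point mul0r addr0.
  by rewrite sumr_const card_ord -(mulr_natl (f z0)) normcM normc_natr.
apply: le_trans h _.
have -> : n%:R * (B + 2 * eta * rho) = n%:R * B + m%:R * (n%:R * (2 * eta * (rho / m%:R))).
  by field; rewrite gt_eqF.
rewrite lerD2r; apply: normc_sum_le => k; apply: hB.
by rewrite ring_norm// ltW.
Qed.
End Circle.

(** The Riemann-sum form of the mean value property.  The average of f over the
   n-th roots of unity on a circle is almost independent of the radius, and for
   radius 0 it is the value at the centre. *)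
Lemma mean_value_le K f g z0 (rho B : R) : 0 < rho ->
  (forall z, N (z - z0) <= rho -> K z) -> uniformly_differentiable K f g ->
  (forall z, N (z - z0) = rho -> N (f z) <= B) -> N (f z0) <= B.
Proof.
move=> rho0 disc fd hB; apply/ler_addgt0Pr => e e0.
have eta0 : 0 < e / (2 * rho) by rewrite divr_gt0// mulr_gt0.
have [d d0 hd] := fd _ eta0.
have [n [w [n0 wn w1 Nw]]] := root_unity_near1 (divr_gt0 d0 rho0).
rewrite ltr_pdivlMr// mulrC => wd.
have := @approx_mean_value K f g z0 rho (e / (2 * rho)) d disc hd n w n0 wn w1 Nw wd B rho0 d0 hB.
by congr (_ <= _ + _); field; rewrite gt_eqF.
Qed.

(** * Holomorphic functions vanishing on a disc *)

Lemma quotient_remainder (F : fieldType) (fw fz gz p q : F) : p != 0 -> q != 0 ->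
  fw / q - fz / p - (gz / p - fz / p ^+ 2) * (q - p) =
  (fw - fz - gz * (q - p)) / q
  + (fz * p^-1 ^+ 2 / q - gz / p / q) * (q - p) ^+ 2.
Proof. by move=> p0 q0; field; rewrite p0 q0. Qed.

(** The explicit bounds, and the disc of radius e on which the function and its
   derivative vanish, make this class stable under division by z - c. *)
Definition flat_holomorphic K c (e : R) f : Prop := exists g (M : R),
  [/\ uniformly_differentiable K f g, forall z, K z -> N (f z) <= M /\ N (g z) <= M &
      forall z, N (z - c) < e -> f z = 0 /\ g z = 0].

(** Points within e / 2 of c contribute nothing, and elsewhere the denominators
   are bounded below. *)
Lemma flat_holomorphic_div K c (e : R) f : 0 < e -> flat_holomorphic K c e f ->
  flat_holomorphic K c e (fun z => f z / (z - c)).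
Proof.
move=> e0 [g [M0 [fd bd fl]]].
pose M := Num.max M0 0.
have M_ge0 : 0 <= M by rewrite le_max lexx orbT.
have {}bd z : K z -> N (f z) <= M /\ N (g z) <= M.
  by move=> /bd[h1 h2]; rewrite !le_max h1 h2.
pose C := 2 / e.
have C0 : 0 < C by rewrite divr_gt0.
have far z : ~~ (N (z - c) < e / 2) -> z - c != 0 /\ N (z - c)^-1 <= C.
  rewrite -leNgt => h; have zc : 0 < N (z - c) by apply: lt_le_trans h; rewrite divr_gt0.
  split; first by rewrite -normc_gt0.
  rewrite ComplexField.Normc.normcV -[C]invrK lef_pV2 ?posrE ?invr_gt0//.
  by rewrite /C invf_div.
clearbody C.
have half z : N (z - c) < e / 2 -> N (z - c) < e.
  by move=> h; apply: lt_trans h _; rewrite ltr_pdivrMr// ltr_pMr// ltr1n.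
exists (fun z => g z / (z - c) - f z / (z - c) ^+ 2), (M * C + M * C ^+ 2); split.
- move=> eta eta0.
  have [d1 d10 hd1] := fd _ (divr_gt0 eta0 (mulr_gt0 (ltr0Sn R 1) C0)).
  pose L := M * C ^+ 3 + M * C ^+ 2 + 1.
  have L0 : 0 < L.
    by rewrite ltr_wpDl// addr_ge0// mulr_ge0// exprn_ge0// ltW.
  exists (Num.min d1 (Num.min (e / 2) (eta / (2 * L)))).
    by rewrite !lt_min d10 !divr_gt0// mulr_gt0.
  move=> z w Kz Kw; rewrite !lt_min => /and3P[td1 te tL].
  have [[zn|/far[zp Nz]] [wn|/far[wp Nw]]] :=
    (boolP (N (z - c) < e / 2), boolP (N (w - c) < e / 2)).
  + have [-> ->] := fl _ (half _ zn); have [-> _] := fl _ (half _ wn).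
    by rewrite !mul0r !subrr mul0r subrr ComplexField.Normc.normc0 mulr_ge0// ?normc_ge0// ltW.
  + have [-> ->] := fl _ (half _ zn).
    have [-> _] : f w = 0 /\ g w = 0.
      apply: fl; have -> : w - c = (w - z) + (z - c) by ring.
      by apply: le_lt_trans (normcD _ _) _; rewrite (splitr e); exact: ltrD.
    by rewrite !mul0r !subrr mul0r subrr ComplexField.Normc.normc0 mulr_ge0// ?normc_ge0// ltW.
  + have [-> _] := fl _ (half _ wn).
    have [-> ->] : f z = 0 /\ g z = 0.
      apply: fl; have -> : z - c = (z - w) + (w - c) by ring.
      by apply: le_lt_trans (normcD _ _) _; rewrite (splitr e) normcBC; exact: ltrD.
    by rewrite !mul0r !subrr mul0r subrr ComplexField.Normc.normc0 mulr_ge0// ?normc_ge0// ltW.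
  + have E : w - z = (w - c) - (z - c) by ring.
    rewrite {1}E quotient_remainder// -E.
    have [b1 b2] := bd _ Kz.
    set t := N (w - z) in td1 te tL *.
    have t0 : 0 <= t by exact: normc_ge0.
    have h1 : N ((f w - f z - g z * (w - z)) / (w - c)) <= eta / 2 * t.
      rewrite normcM; have -> : eta / 2 * t = (eta / (2 * C) * t) * C by field; rewrite gt_eqF.
      by apply: ler_pM; rewrite ?normc_ge0//; exact: hd1.
    have h2 : N (f z * (z - c)^-1 ^+ 2 / (w - c) - g z / (z - c) / (w - c))
        <= M * C ^+ 3 + M * C ^+ 2.
      apply: le_trans (normcD _ _) _; rewrite normc_opp !normcM exprSr expr2 !mulrA.
      apply: lerD; last first.
        apply: ler_pM; rewrite ?mulr_ge0 ?normc_ge0//.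
        by apply: ler_pM; rewrite ?normc_ge0.
      apply: ler_pM; rewrite ?mulr_ge0 ?normc_ge0//.
      apply: ler_pM; rewrite ?mulr_ge0 ?normc_ge0//.
      by apply: ler_pM; rewrite ?mulr_ge0 ?normc_ge0.
    apply: le_trans (normcD _ _) _.
    have -> : eta * t = eta / 2 * t + eta / 2 * t by field.
    apply: lerD => //; rewrite normcM normcX -/t expr2 mulrA.
    apply: ler_wpM2r => //.
    move: tL; rewrite ltr_pdivlMr ?mulr_gt0// => tL.
    apply: (le_trans (y := L * t)).
      by apply: ler_wpM2r => //; apply: le_trans h2 _; rewrite lerDl.
    by rewrite ler_pdivlMr// ltW//; have -> : L * t * 2 = t * (2 * L) by ring.
- move=> z Kz; have [b1 b2] := bd z Kz.
  have [zn|/far[zp Nz]] := boolP (N (z - c) < e / 2).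
    have [-> ->] := fl _ (half _ zn).
    rewrite !mul0r subrr ComplexField.Normc.normc0.
    by rewrite addr_ge0// mulr_ge0// ?exprn_ge0// ltW.
  have q1 : N (f z / (z - c)) <= M * C.
    by rewrite normcM; apply: ler_pM; rewrite ?normc_ge0.
  split; first by apply: le_trans q1 _; rewrite lerDl mulr_ge0// exprn_ge0// ltW.
  apply: le_trans (normcD _ _) _; rewrite normc_opp; apply: lerD.
    by rewrite normcM; apply: ler_pM; rewrite ?normc_ge0.
  rewrite normcM -exprVn normcX; apply: ler_pM; rewrite ?exprn_ge0 ?normc_ge0//.
  by rewrite lerXn2r// nnegrE ?normc_ge0// ltW.
- by move=> z /fl[-> ->]; rewrite !mul0r subrr.
Qed.

Lemma flat_holomorphic_divX K c (e : R) f k : 0 < e -> flat_holomorphic K c e f ->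
  flat_holomorphic K c e (fun z => f z / (z - c) ^+ k).
Proof.
move=> e0 h; elim: k => [|k IH].
  by under eq_fun do rewrite expr0 divr1.
have := flat_holomorphic_div e0 IH; congr flat_holomorphic.
by apply/funext => z; rewrite exprSr invfM mulrA.
Qed.

(** The mean value inequality for f / (z - c) ^ k on the circle of centre z0 and
   radius rho gives |f z0| <= M (d / (rho - d)) ^ k with d = |z0 - c|, and this
   ratio is less than 1 because d < rho / 2. *)
Lemma flat_holomorphic_vanish K c (e : R) f z0 (rho : R) : 0 < e -> flat_holomorphic K c e f ->
  (forall z, N (z - z0) <= rho -> K z) -> N (z0 - c) < rho / 2 -> f z0 = 0.
Proof.
move=> e0 fh disc; set d := N (z0 - c) => hd.
have [zc|zc] := eqVneq z0 c.
  have [g [M [_ _ fl]]] := fh.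
  by have [] := fl z0; rewrite // zc subrr ComplexField.Normc.normc0.
have d0 : 0 < d by rewrite normc_gt0 subr_eq0.
have rho0 : 0 < rho by rewrite -(pmulr_lgt0 _ (_ : 0 < 2^-1)) ?invr_gt0// (lt_trans d0).
have r0 : 0 < rho - d by rewrite subr_gt0 (lt_trans hd)// ltr_pdivrMr// ltr_pMr// ltr1n.
pose q := d / (rho - d).
have q0 : 0 < q by rewrite divr_gt0.
have q1 : q < 1.
  by rewrite ltr_pdivrMr// mul1r ltrBrDr (splitr rho); exact: ltrD.
have [g [M [_ bd _]]] := fh.
have bound k : N (f z0) <= M * q ^+ k.
  have [gk [Mk [fdk _ _]]] := flat_holomorphic_divX k e0 fh.
  have : N (f z0 / (z0 - c) ^+ k) <= M / (rho - d) ^+ k.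
    apply: (mean_value_le rho0 disc fdk) => z zr.
    rewrite normcM -exprVn normcX -exprVn; apply: ler_pM; rewrite ?exprn_ge0 ?normc_ge0//.
      by have [] := bd z (disc _ _); rewrite ?zr.
    have zcr : rho - d <= N (z - c).
      rewrite lerBlDr -zr; have -> : z - z0 = (z - c) + (c - z0) by ring.
      by apply: le_trans (normcD _ _) _; rewrite (normcBC c).
    rewrite ComplexField.Normc.normcV lerXn2r// ?nnegrE ?invr_ge0 ?normc_ge0 ?(ltW r0)//.
    by rewrite lef_pV2// posrE (lt_le_trans r0).
  rewrite normcM -exprVn normcX ComplexField.Normc.normcV -/d => h.
  have -> : N (f z0) = (N (f z0) * d^-1 ^+ k) * d ^+ k.
    by rewrite -mulrA -exprMn mulVf ?gt_eqF// expr1n mulr1.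
  apply: le_trans (_ : M / (rho - d) ^+ k * d ^+ k <= _).
    by rewrite ler_wpM2r// exprn_ge0// ltW.
  by rewrite -mulrA -exprVn -exprMn [_^-1 * _]mulrC.
apply/eqP; rewrite -normc_eq0 eq_le normc_ge0 andbT leNgt; apply/negP => x0.
have lim : M * q ^+ k @[k --> \oo] --> M * 0.
  by apply: cvgM; [exact: cvg_cst|apply: cvg_expr; rewrite gtr0_norm].
move/cvgrPdist_lt/(_ _ x0): lim => [k _ /(_ k (leqnn _))] /=.
rewrite mulr0 sub0r normrN => h.
by have := le_lt_trans (le_trans (bound k) (ler_norm _)) h; rewrite ltxx.
Qed.
End UniqueContinuation.

(** * Connectedness and compactness in the plane *)

Section ConnectedSets.

Lemma connected_relatively_clopen (T : topologicalType) (D E : set T) :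
  connected D -> E `<=` D -> E !=set0 -> open E ->
  (forall u, D u -> closure E u -> E u) -> E = D.
Proof.
move=> cD ED E0 oE clE; apply: cD => //.
  by exists E => //; apply/seteqP; split=> [x Ex|x []//]; split=> //; exact: ED.
exists (closure E); first exact: closed_closure.
apply/seteqP; split=> [x Ex|x [Dx]]; last exact: clE.
by split; [exact: ED|exact: subset_closure].
Qed.

End ConnectedSets.

Section PlaneCompactness.
Variable R : realType.
Implicit Types (f : 'rV[R]_2 -> R) (u v x y : 'rV[R]_2) (D B : set 'rV[R]_2).

Definition box u (r : R) : set 'rV[R]_2 := [set v | `|v - u| <= r].

Lemma box_compact u r : compact (box u r).
Proof.
have -> : box u r = [set v | forall i, `[u 0 i - r, u 0 i + r]%classic (v 0 i)].
  apply/seteqP; split=> v; rewrite /box/= norm_rV2_le !mxE.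
    by move=> /andP[h0 h1]; elim/ord2_ind; rewrite in_itv/= -ler_distlC distrC.
  by move=> h; rewrite !(distrC (v _ _)) !ler_distlC; move: (h 0) (h 1); rewrite !in_itv/= => -> ->.
exact: (@rV_compact R 2 (fun i => `[u 0 i - r, u 0 i + r]%classic)
  (fun i => @segment_compact R _ _)).
Qed.

Lemma box_sub D u : open D -> D u -> exists2 r : R, 0 < r & box u r `<=` D.
Proof.
move=> oD Du; have /nbhs_ballP[d /= d0 hd] : nbhs u D by exact: open_nbhs_nbhs.
exists (d / 2); first by rewrite divr_gt0.
move=> v; rewrite /box/= => h; apply: hd; rewrite -ball_normE /ball_/= distrC.
by apply: le_lt_trans h _; rewrite ltr_pdivrMr// ltr_pMr// ltr1n.
Qed.

(** Strict differentiability holds locally with uniform errors, so a covering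
   argument makes the error uniform over a compact set. *)
Lemma C1_uniform D B f (eta : R) : open D -> C1 D f -> compact B -> B `<=` D ->
  0 < eta -> exists2 d : R, 0 < d & forall x y, B x -> `|y - x| < d ->
    `|f y - f x - (pderiv 0 f x * (y 0 0 - x 0 0) + pderiv 1 f x * (y 0 1 - x 0 1))|
    <= eta * `|y - x|.
Proof.
move=> oD df /compact_near_coveringP cB BD e0.
pose P (d : R) x := forall y, `|y - x| < d ->
    `|f y - f x - (pderiv 0 f x * (y 0 0 - x 0 0) + pderiv 1 f x * (y 0 1 - x 0 1))|
    <= eta * `|y - x|.
have : \forall d \near 0^'+, B `<=` P d.
  apply: cB => u /BD Du; have [d d0 hd] := C1_strict oD df Du e0.
  have d2 : 0 < d / 2 by rewrite divr_gt0.
  have hA : \forall x \near u, `|x - u| < d / 2.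
    by apply/nbhs_ballP; exists (d / 2) => // x; rewrite -ball_normE /ball_/= distrC.
  have hB : \forall e \near (0 : R)^'+, e < d / 2 by exact: nbhs_right_lt.
  exists ([set x | `|x - u| < d / 2], [set e | e < d / 2]); first by [].
  move=> [x e] /= [hx he] y hy.
  have hyx : `|y - x| < d / 2 by apply: lt_trans he.
  have half : d / 2 < d by rewrite ltr_pdivrMr// ltr_pMr// ltr1n.
  apply: (proj2 (hd x y (lt_trans hx half) _)).
  rewrite -(subrKA x); apply: le_lt_trans (ler_normD _ _) _.
  by rewrite (splitr d); exact: ltrD.
move=> h; near (0 : R)^'+ => d.
have d0 : 0 < d by near: d; exact: nbhs_right_gt.
have hd : B `<=` P d by near: d.
by exists d => // x y Bx; exact: hd.
Unshelve. all: by end_near. Qed.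

Lemma continuous_compact_bounded B f : compact B ->
  (forall x, B x -> {for x, continuous f}) -> exists M : R, forall x, B x -> `|f x| <= M.
Proof.
move=> /compact_near_coveringP cB cf.
have : \forall M \near +oo, B `<=` (fun x => `|f x| <= M).
  apply: cB => u Bu.
  have hA : \forall x \near u, `|f u - f x| < 1 by have /cvgrPdist_lt/(_ 1 ltr01) := cf u Bu.
  have hB : \forall M \near +oo, `|f u| + 1 <= M by exact: nbhs_pinfty_ge.
  exists ([set x | `|f u - f x| < 1], [set M | `|f u| + 1 <= M]); first by [].
  move=> [x M] /= [hx hM]; apply: le_trans hM.
  have -> : f x = f u - (f u - f x) by rewrite opprB addrC subrK.
  by apply: le_trans (ler_normB _ _) _; rewrite lerD2l ltW.
move=> h; near (pinfty_nbhs R) => M.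
by exists M; near: M.
Unshelve. all: by end_near. Qed.

Lemma C1_continuous D f u : open D -> C1 D f -> D u -> {for u, continuous f}.
Proof.
move=> oD df Du; have [d d0 hd] := C1_strict oD df Du ltr01.
set A := `|pderiv 0 f u| + `|pderiv 1 f u| + 1.
have A0 : 0 < A by rewrite ltr_wpDl// addr_ge0.
apply/(@cvgrPdist_lt _ _ _ (nbhs u) (nbhs_filter u)) => e e0.
apply/nbhs_ballP; exists (Num.min d (e / A)); first by rewrite /= lt_min d0 divr_gt0.
move=> y; rewrite -ball_normE /ball_/= distrC lt_min => /andP[yd ye].
have u0 : `|u - u| < d by rewrite subrr normr0.
have [_] := hd u y u0 yd; rewrite mul1r => h.
have [/andP[y0 y1]] : (`|y 0 0 - u 0 0| <= `|y - u|) && (`|y 0 1 - u 0 1| <= `|y - u|).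
  by have := lexx `|y - u|; rewrite {1}norm_rV2_le !mxE.
rewrite distrC; apply: le_lt_trans (_ : A * `|y - u| < e); last first.
  by rewrite mulrC -ltr_pdivlMr.
set L := pderiv 0 f u * _ + _ in h.
have -> : f y - f u = (f y - f u - L) + L by rewrite subrK.
have -> : A * `|y - u| = `|y - u| + (`|pderiv 0 f u| * `|y - u| + `|pderiv 1 f u| * `|y - u|).
  by rewrite /A !mulrDl mul1r addrC.
apply: le_trans (ler_normD _ _) _; apply: lerD => //.
rewrite /L; apply: le_trans (ler_normD _ _) _; rewrite !normrM.
exact: (lerD (ler_wpM2l (normr_ge0 _) y0) (ler_wpM2l (normr_ge0 _) y1)).
Qed.

(** By the mean value theorem f is locally constant, so its level sets in D are
   open and relatively closed. *)
Lemma gradient0_constant D f : is_domain D -> C1 D f ->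
  (forall u, D u -> forall i, pderiv i f u = 0) -> forall x y, D x -> D y -> f x = f y.
Proof.
move=> [_ oD cD] df g0 x y Dx Dy.
have loc u : D u -> \forall v \near u, f v = f u.
  move=> Du; have [d d0 hd] : exists2 d : R, 0 < d & forall v, `|v - u| < d -> f v = f u.
    have /nbhs_ballP[d /= d0 hd] : nbhs u D by exact: open_nbhs_nbhs.
    have hD v : `|v - u| < d -> D v.
      by move=> hv; apply: hd; rewrite -ball_normE /ball_/= distrC.
    exists d => // v hv; apply/eqP; rewrite -subr_eq0; apply/eqP.
    have u0 : `|u - u| < d by rewrite subrr normr0.
    have [|p [q [hp hq ->]]] := @mvt_plane _ f u d u v u0 hv.
      by move=> w /hD Dw i; exact: C1_derivable df Dw.
    by rewrite !g0 ?mul0r ?addr0//; exact: hD.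
  by apply/nbhs_ballP; exists d => // v; rewrite -ball_normE /ball_/= distrC => /hd.
pose E := [set u | D u /\ f u = f x].
have : E = D; last by move=> ED; have [] : E y by rewrite ED.
apply: connected_relatively_clopen => //.
- by move=> u [].
- by exists x.
- rewrite openE => u [Du fu]; apply: filterS (filterI (loc u Du) (open_nbhs_nbhs (conj oD Du))).
  by move=> v [fv Dv]; split=> //; rewrite fv.
- move=> u Du cl; split=> //.
  by have [v [[_ <-] ->]] := cl _ (loc u Du).
Qed.
End PlaneCompactness.

(** * Unique continuation for the Cauchy-Riemann equations *)

Section CauchyRiemann.
Variable R : realType.
Implicit Types (U V : 'rV[R]_2 -> R) (u v x y : 'rV[R]_2) (D : set 'rV[R]_2).
Implicit Types (z w c : R[i]).
Local Notation N := (@ComplexField.Normc.normc R).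

Definition cauchy_riemann D U V : Prop := [/\ C1 D U, C1 D V,
  forall u, D u -> pderiv 0 U u = pderiv 1 V u &
  forall u, D u -> pderiv 1 U u = - pderiv 0 V u].

Definition plane_point z : 'rV[R]_2 :=
  \row_j (if j == 0 then complex.Re z else complex.Im z).

Lemma zcoordK : cancel (@zcoord R) plane_point.
Proof. by move=> u; apply/rowP; elim/ord2_ind; rewrite !mxE. Qed.

Lemma plane_pointK : cancel plane_point (@zcoord R).
Proof. by case=> a b; rewrite /zcoord !mxE. Qed.

Lemma plane_point_dist z w : `|plane_point z - plane_point w| <= N (z - w).
Proof.
rewrite norm_rV2_le !mxE /= -!raddfB; apply/andP.
by split; [exact: normc_Re|exact: normc_Im].
Qed.

Lemma zcoord_dist u v : N (zcoord u - zcoord v) <= 2 * `|u - v|.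
Proof.
apply: le_trans (normc_le_ReIm _) _ => /=.
have /andP[h0 h1] : (`|u 0 0 - v 0 0| <= `|u - v|) && (`|u 0 1 - v 0 1| <= `|u - v|).
  by have := lexx `|u - v|; rewrite {1}norm_rV2_le !mxE.
by rewrite mulr_natl mulr2n; exact: lerD.
Qed.

(** The passage from real partial derivatives to the complex derivative
   U_1 + i V_1, with the uniformity provided by a compact box. *)
Lemma cauchy_riemann_flat D U V u (r : R) c (e : R) : open D ->
  cauchy_riemann D U V -> box u r `<=` D -> 0 < e ->
  (forall v, N (zcoord v - c) < e -> U v = 0 /\ V v = 0) ->
  flat_holomorphic [set z | box u r (plane_point z)] c e
    (fun z => U (plane_point z) +i* V (plane_point z)).
Proof.
move=> oD [dU dV cr1 cr2] BD e0 fl.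
have cB := @box_compact R u r.
have bounded (f : 'rV[R]_2 -> R) (hf : forall x, D x -> {for x, continuous f}) :
    exists M : R, forall x, box u r x -> `|f x| <= M.
  by apply: continuous_compact_bounded cB _ => x /BD; exact: hf.
have [M1 b1] := bounded U (fun x Dx => C1_continuous oD dU Dx).
have [M2 b2] := bounded V (fun x Dx => C1_continuous oD dV Dx).
have [M3 b3] := bounded (pderiv 0 U) (fun x Dx => (dU x Dx 0).2).
have [M4 b4] := bounded (pderiv 0 V) (fun x Dx => (dV x Dx 0).2).
exists (fun z => pderiv 0 U (plane_point z) +i* pderiv 0 V (plane_point z)).
exists (Num.max (M1 + M2) (M3 + M4)); split.
- move=> eta eta0; have eta2 : 0 < eta / 2 by rewrite divr_gt0.
  have [d1 d10 h1] := C1_uniform oD dU cB BD eta2.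
  have [d2 d20 h2] := C1_uniform oD dV cB BD eta2.
  exists (Num.min d1 d2); first by rewrite lt_min d10.
  move=> z w Kz Kw; rewrite lt_min => /andP[hd1 hd2].
  have Dz := BD _ Kz.
  have wz := plane_point_dist w z.
  have := h1 _ _ Kz (le_lt_trans wz hd1); have := h2 _ _ Kz (le_lt_trans wz hd2).
  rewrite (cr2 _ Dz) -(cr1 _ Dz) !mxE /=.
  move: (pderiv 0 U _) (pderiv 0 V _) (U _) (U _) (V _) (V _) => p q U1 U2 V1 V2 e2 e1.
  apply: le_trans (normc_le_ReIm _) _.
  have -> : eta * N (w - z) = eta / 2 * N (w - z) + eta / 2 * N (w - z) by field.
  have wz' : eta / 2 * `|plane_point w - plane_point z| <= eta / 2 * N (w - z).
    by rewrite ler_wpM2l// ltW.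
  apply: lerD; apply: le_trans wz'; [move: e1 {e2}|move: e2 {e1}]; apply: le_trans;
    rewrite le_eqVlt; apply/orP; left; apply/eqP; congr `|_|;
    case: z w {h1 h2 hd1 hd2 wz Kz Kw Dz} => [a b] [a' b'] /=; ring.
- move=> z Kz; rewrite !le_max; split; apply/orP; [left|right];
    apply: le_trans (normc_le_ReIm _) _.
    by apply: lerD; [exact: b1|exact: b2].
  by apply: lerD; [exact: b3|exact: b4].
- move=> z zc.
  have hz := fl (plane_point z); rewrite plane_pointK in hz.
  have [-> ->] := hz zc; split=> //.
  have nz : \forall v \near plane_point z, U v = 0 /\ V v = 0.
    pose d := e - N (z - c); have d0 : 0 < d by rewrite subr_gt0.
    apply/nbhs_ballP; exists (d / 2); first by rewrite /= divr_gt0.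
    move=> v; rewrite -ball_normE /ball_/= distrC ltr_pdivlMr// mulrC => hv; apply: fl.
    have -> : zcoord v - c = (zcoord v - zcoord (plane_point z)) + (z - c).
      by rewrite plane_pointK; ring.
    apply: le_lt_trans (normcD _ _) _; rewrite -ltrBrDr.
    exact: le_lt_trans (zcoord_dist _ _) hv.
  rewrite (@pderiv_near _ _ U (fun=> 0)); last by apply: filterS nz => v [].
  rewrite (@pderiv_near _ _ V (fun=> 0)); last by apply: filterS nz => v [].
  by rewrite !pderiv_cst.
Qed.

(** The interior of the zero set is relatively closed: a point of its closure is
   so near to some c around which U and V vanish that
   [flat_holomorphic_vanish] reaches a whole neighbourhood of that point. *)
Lemma cauchy_riemann_unique_continuation D U V u0 : is_domain D ->
  cauchy_riemann D U V -> D u0 -> (\forall v \near u0, U v = 0 /\ V v = 0) ->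
  forall u, D u -> U u = 0 /\ V u = 0.
Proof.
move=> [_ oD cD] cr Du0 h0.
pose E := [set u | D u /\ \forall v \near u, U v = 0 /\ V v = 0].
suff : E = D.
  by move=> ED u; rewrite -ED => -[_ /nbhs_singleton].
apply: connected_relatively_clopen => //.
- by move=> u [].
- by exists u0.
- rewrite openE => u [Du /nbhs_interior hA].
  by apply: filterS (filterI hA (open_nbhs_nbhs (conj oD Du))) => v [nv Dv]; split.
- move=> u Du clu; split=> //.
  have [r r0 rD] := box_sub oD Du.
  pose s := r / 16; have s0 : 0 < s by rewrite divr_gt0.
  have ns : nbhs u (ball u s) by exact: nbhsx_ballx.
  have [c [[Dc nc] uc]] := clu _ ns.
  apply: filterS ns => v uv.
  have /nbhs_ballP[d /= d0 hd] := nc.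
  have flc (w : 'rV[R]_2) : N (zcoord w - zcoord c) < d -> U w = 0 /\ V w = 0.
    move=> h; apply: hd; rewrite -ball_normE /ball_/= distrC.
    by apply: le_lt_trans h; rewrite -{1}[w]zcoordK -{1}[c]zcoordK; exact: plane_point_dist.
  have fh := cauchy_riemann_flat oD cr rD d0 flc.
  move: uc uv; rewrite -!ball_normE /ball_/= => uc uv.
  have : U (plane_point (zcoord v)) +i* V (plane_point (zcoord v)) = 0.
    apply: (flat_holomorphic_vanish (z0 := zcoord v) (rho := r / 2) d0 fh).
      move=> z hz; rewrite /box/=.
      have := plane_point_dist z (zcoord v); rewrite zcoordK => h.
      rewrite -(subrKA v); apply: le_trans (ler_normD _ _) _.
      rewrite (distrC v) (splitr r); apply: lerD; first exact: le_trans hz.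
      by apply: le_trans (ltW uv) _; rewrite /s; lra.
    apply: le_lt_trans (zcoord_dist _ _) _.
    have : `|v - c| < s + s.
      rewrite -(subrKA u); apply: le_lt_trans (ler_normD _ _) _; rewrite (distrC v).
      exact: ltrD.
    by rewrite /s; lra.
  by rewrite zcoordK => -[-> ->].
Qed.
End CauchyRiemann.

(** * Functions of one complex variable and the Cauchy-Riemann equations *)

Section Holomorphy.
Variable R : realType.
Implicit Types (u v : 'rV[R]_2) (D : set 'rV[R]_2) (a : 'rV[R]_2 -> R[i]).
Implicit Types (z w h : R[i]) (s t : R).
Local Notation N := (@ComplexField.Normc.normc R).
Let normcM := @ComplexField.Normc.normcM R.

Definition linear_approx (F : R[i] -> R[i]) z (l : R[i]) : Prop :=
  forall eta : R, 0 < eta -> exists2 d : R, 0 < d &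
    forall h, N h < d -> N (F (h + z) - F z - l * h) <= eta * N h.

Lemma normc_normE z : `|z| = (N z)%:C.
Proof. by case: z. Qed.

Lemma linear_approx_derivable F z l : linear_approx F z l ->
  derivable (F : R[i]^o -> R[i]^o) z 1.
Proof.
move=> H; apply/cvg_ex; exists l; apply/cvgrPdist_lt => e e0.
have eE : e = (complex.Re e)%:C by rewrite RRe_real// gtr0_real.
have r0 : 0 < complex.Re e by rewrite -ltcR -eE.
have [d d0 hd] := H (complex.Re e / 2) (divr_gt0 r0 (ltr0Sn R 1)).
apply/nbhs_ballP; exists d%:C; first by rewrite /= ltcR.
move=> h; rewrite -ball_normE /ball_/= sub0r normrN normc_normE ltcR => hh h0.
have Nh : 0 < N h by rewrite normc_gt0.
rewrite [X in F (X + _)]mulr1 distrC normc_normE eE ltcR.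
have -> : h^-1 *: (F (h + z) - F z) - l = (F (h + z) - F z - l * h) / h.
  by rewrite mulrBl mulfK// [_ / h]mulrC.
rewrite normcM ComplexField.Normc.normcV ltr_pdivrMr//.
apply: le_lt_trans (hd h hh) _; rewrite ltr_pM2r//.
by rewrite ltr_pdivrMr// ltr_pMr// ltr1n.
Qed.

Lemma derivable_linear_approx F z : derivable (F : R[i]^o -> R[i]^o) z 1 ->
  exists l, linear_approx F z l.
Proof.
move=> /cvg_ex[l /cvgrPdist_lt H]; exists l => eta eta0.
have e0 : 0 < eta%:C by rewrite ltcR.
have /nbhs_ballP[d /= d0 hd] := H _ e0.
have dE : d = (complex.Re d)%:C by rewrite RRe_real// gtr0_real.
exists (complex.Re d); first by rewrite -ltcR -dE.
move=> h hh; have [->|h0] := eqVneq h 0.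
  by rewrite add0r subrr mulr0 subrr ComplexField.Normc.normc0 mulr0.
have := hd h; rewrite -ball_normE /ball_/= sub0r normrN normc_normE dE ltcR.
move=> /(_ hh h0); rewrite [X in F (X + _)]mulr1 distrC normc_normE ltcR => hn.
have -> : F (h + z) - F z - l * h = (h^-1 *: (F (h + z) - F z) - l) * h.
  by rewrite mulrBl [_ *: _]mulrC mulfVK.
by rewrite normcM ler_wpM2r ?normc_ge0// ltW.
Qed.

Lemma derive_linear_approx (f : 'rV[R]_2 -> R) u v (c : R) :
  (forall eta : R, 0 < eta -> exists2 d : R, 0 < d &
    forall t, `|t| < d -> `|f (t *: v + u) - f u - c * t| <= eta * `|t|) ->
  'D_v f u = c.
Proof.
move=> H; apply: cvg_lim => //; apply/cvgrPdist_lt => e e0.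
have [d d0 hd] := H (e / 2) (divr_gt0 e0 (ltr0Sn R 1)).
apply/nbhs_ballP; exists d; first by [].
move=> h; rewrite -ball_normE /ball_/= sub0r normrN => hh h0.
have Nh : 0 < `|h| by rewrite normr_gt0.
rewrite distrC.
have -> : h^-1 *: (f (h *: v + u) - f u) - c = (f (h *: v + u) - f u - c * h) / h.
  by rewrite mulrBl mulfK// [_ / h]mulrC.
rewrite normrM normfV ltr_pdivrMr//.
apply: le_lt_trans (hd h hh) _; rewrite ltr_pM2r//.
by rewrite ltr_pdivrMr// ltr_pMr// ltr1n.
Qed.

(** [s = 1] gives u^1 + i u^2 and [s = -1] gives u^1 - i u^2. *)
Definition signed_coord s u : R[i] := u 0 0 +i* (s * u 0 1).

Lemma signed_coordD s u t i :
  signed_coord s (t *: 'e_i + u) = t%:C * (if i == 0 then 1 else s%:C * 'i) + signed_coord s u.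
Proof.
elim/ord2_ind: i; rewrite /signed_coord !mxE /=; congr (_ +i* _) => /=; ring.
Qed.

(** Moving u along e_1 and e_2 moves the complex variable along 1 and s i, so
   both partial derivatives are read off from the same complex derivative. *)
Lemma function_of_cpderiv (s : R) D a u : open D -> function_of (signed_coord s) D a ->
  D u -> cpderiv 1 a u = s%:C * 'i * cpderiv 0 a u.
Proof.
move=> oD [F holF aF] Du.
have [l hl] : exists l, linear_approx F (signed_coord s u) l.
  by apply: derivable_linear_approx; apply: holF; exists u.
suff H i : cpderiv i a u = l * (if i == 0 then 1 else s%:C * 'i).
  by rewrite !H /= mulr1 mulrC.
set k := (if i == 0 then 1 else s%:C * 'i).
have K0 : 0 < N k + 1 by rewrite ltr_wpDl// normc_ge0.
have [r r0 rD] := box_sub oD Du.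
have approx (eta : R) : 0 < eta -> exists2 d : R, 0 < d &
    forall t, `|t| < d -> N (a (t *: 'e_i + u) - a u - l * k * t%:C) <= eta * `|t|.
  move=> eta0; have [d d0 hd] := hl _ (divr_gt0 eta0 K0).
  exists (Num.min r (d / (N k + 1))); first by rewrite lt_min r0 divr_gt0.
  move=> t; rewrite lt_min ltr_pdivlMr// => /andP[tr td].
  have Dt : D (t *: 'e_i + u).
    apply: rD; rewrite /box/= addrK; apply: le_trans (norm_delta_le _ _) _.
    exact: ltW.
  have Nt : N (t%:C * k) <= `|t| * (N k + 1).
    by rewrite normcM normc_real ler_wpM2l// lerDl.
  rewrite !aF// signed_coordD -/k -mulrA (mulrC k).
  apply: le_trans (hd _ (le_lt_trans Nt td)) _.
  apply: le_trans (_ : eta / (N k + 1) * (`|t| * (N k + 1)) <= _).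
    by rewrite ler_wpM2l// divr_ge0// ltW.
  by rewrite mulrACA mulVf ?gt_eqF// mulr1.
rewrite /cpderiv /pderiv; case: (l * k) approx => p q approx.
by congr (_ +i* _); apply: derive_linear_approx => eta eta0;
  have [d d0 hd] := approx eta eta0; exists d => // t /hd; apply: le_trans;
  [apply: le_trans (normc_Re _)|apply: le_trans (normc_Im _)];
  rewrite le_eqVlt; apply/orP; left; apply/eqP; congr `|_|;
  case: (a _) (a u) => [x y] [x' y'] /=; ring.
Qed.

(** The function of one variable is a itself, read in the coordinates
   (Re z, s Im z), which invert [signed_coord s] because s = s^-1. *)
Lemma cauchy_riemann_function_of (s : R) D a : open D -> s * s = 1 ->
  C1 D (fun u => complex.Re (a u)) -> C1 D (fun u => complex.Im (a u)) ->
  (forall u, D u -> cpderiv 1 a u = s%:C * 'i * cpderiv 0 a u) ->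
  function_of (signed_coord s) D a.
Proof.
move=> oD ss dU dV cr.
set U := (fun u => complex.Re (a u)) in dU; set V := (fun u => complex.Im (a u)) in dV.
have ns : `|s| = 1 by apply/eqP; rewrite -sqr_norm_eq1 expr2 ss.
pose P z := plane_point (complex.Re z +i* (s * complex.Im z)).
have PK u : P (signed_coord s u) = u.
  by apply/rowP; elim/ord2_ind; rewrite !mxE //= mulrA ss mul1r.
exists (fun z => a (P z)); last by move=> u _; rewrite PK.
move=> _ [u Du <-]; apply: (linear_approx_derivable (l := cpderiv 0 a u)) => eta eta0.
have eta2 : 0 < eta / 2 by rewrite divr_gt0.
have [d1 d10 h1] := C1_strict oD dU Du eta2.
have [d2 d20 h2] := C1_strict oD dV Du eta2.
exists (Num.min d1 d2); first by rewrite lt_min d10.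
move=> h; rewrite lt_min => /andP[hd1 hd2].
have E : P (h + signed_coord s u) = P h + u.
  by apply/rowP; elim/ord2_ind; rewrite !mxE /= raddfD/= ?mulrDr ?mulrA ?ss ?mul1r.
have NP : `|P h + u - u| <= N h.
  by rewrite addrK norm_rV2_le !mxE /= normrM ns mul1r normc_Re normc_Im.
have uu d : 0 < d -> `|u - u| < d by rewrite subrr normr0.
have [_] := h1 u _ (uu _ d10) (le_lt_trans NP hd1).
have [_] := h2 u _ (uu _ d20) (le_lt_trans NP hd2).
have [cr1 cr2] : pderiv 1 U u = - s * pderiv 0 V u /\ pderiv 1 V u = s * pderiv 0 U u.
  have [] := cr u Du; rewrite -/U -/V => -> ->; split; ring.
rewrite cr1 cr2 !mxE /= !addrK E PK /cpderiv -/U -/V.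
move: (pderiv 0 U _) (pderiv 0 V _) => p q e2 e1.
apply: le_trans (normc_le_ReIm _) _.
have -> : eta * N h = eta / 2 * N h + eta / 2 * N h by field.
rewrite addrK in NP.
have hN : eta / 2 * `|P h| <= eta / 2 * N h by rewrite ler_wpM2l// ltW.
apply: lerD; apply: le_trans hN; [move: e1 {e2}|move: e2 {e1}]; apply: le_trans;
  rewrite le_eqVlt; apply/orP; left; apply/eqP; congr `|_|; rewrite /U /V.
  have -> : - s * q * (s * complex.Im h) = - (s * s) * (q * complex.Im h) by ring.
  by rewrite ss; move: (a (P h + u)) => [x y]; move: (a u) (h) => [x' y'] [x1 y1] /=; ring.
have -> : s * p * (s * complex.Im h) = s * s * (p * complex.Im h) by ring.
by rewrite ss; move: (a (P h + u)) => [x y]; move: (a u) (h) => [x' y'] [x1 y1] /=; ring.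
Qed.

End Holomorphy.

(** * Conformally flat metrics in dimension two *)

(** The curvature tensor as a polynomial identity: F, p and H stand for the
   conformal factor, its gradient and its Hessian at a point, and G and dG for
   the Christoffel symbols and their derivatives. *)
Lemma conformal_curvature_identity (K : fieldType) (F : K) (p : 'I_2 -> K)
    (H : 'I_2 -> 'I_2 -> K) (i j k l : 'I_2) :
  2%:R != 0 :> K -> F != 0 -> H 0 1 = H 1 0 ->
  let G i j k := - 2%:R^-1 * ((i == k)%:R * (p j / F) + (i == j)%:R * (p k / F)
    - (j == k)%:R * (p i / F)) in
  let dG l i j k := - 2%:R^-1 *
   ((i == k)%:R * (H l j / F - p j * p l / F ^+ 2)
    + (i == j)%:R * (H l k / F - p k * p l / F ^+ 2)
    - (j == k)%:R * (H l i / F - p i * p l / F ^+ 2)) in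
  F * (- dG k j i l + dG l j i k - (G j 0 k * G 0 i l + G j 1 k * G 1 i l)
    + (G j 0 l * G 0 i k + G j 1 l * G 1 i k)) =
  ((i == k)%:R * (j == l)%:R - (i == l)%:R * (j == k)%:R) *
  (2%:R^-1 * (H 0 0 + H 1 1 - (p 0 ^+ 2 + p 1 ^+ 2) / F)).
Proof.
move=> two0 F0 H01; move: i j k l.
do 4!(elim/ord2_ind) => /=; rewrite ?H01; field; rewrite ?two0 ?F0//.
Qed.

Section ConformalGeometry.
Variables (R : realType) (K : fieldType).
Local Notation scalar := ('rV[R]_2 -> K).
Variables (pd : 'I_2 -> scalar -> scalar) (dif : scalar -> 'rV[R]_2 -> Prop).
Implicit Types (f g : scalar) (u v : 'rV[R]_2) (i j k : 'I_2) (D : set 'rV[R]_2).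

(** The rules of differentiation used by the tensor computations, so that these
   are carried out once for the real and for the complex-valued functions. *)
Record differential_calculus : Prop := DifferentialCalculus {
  calculus_near : forall f g u, (\near u, f u = g u) -> dif f u ->
    dif g u /\ forall i, pd i f u = pd i g u;
  calculus_cst : forall c u, dif (fun=> c) u /\ forall i, pd i (fun=> c) u = 0;
  calculusD : forall f g u, dif f u -> dif g u ->
    dif (fun v => f v + g v) u /\
    forall i, pd i (fun v => f v + g v) u = pd i f u + pd i g u;
  calculusM : forall f g u, dif f u -> dif g u ->
    dif (fun v => f v * g v) u /\
    forall i, pd i (fun v => f v * g v) u = f u * pd i g u + pd i f u * g u;
  calculusV : forall f u, f u != 0 -> dif f u ->
    dif (fun v => (f v)^-1) u /\
    forall i, pd i (fun v => (f v)^-1) u = - (f u) ^- 2 * pd i f u }.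

Hypothesis calculus : differential_calculus.

Lemma calculusZ c f u : dif f u ->
  dif (fun v => c * f v) u /\ forall i, pd i (fun v => c * f v) u = c * pd i f u.
Proof.
move=> df; have [dc pc] := calculus_cst calculus c u.
have [d p] := calculusM calculus dc df; split=> // i.
by rewrite p pc mul0r addr0.
Qed.

Definition conformal f : 'rV[R]_2 -> 'M[K]_2 := fun u => (f u)%:M.

Lemma covariant_conformal f u i j :
  covariant (conformal f) u i j = (i == j)%:R * (f u)^-1.
Proof. by rewrite /covariant /conformal invmx_scalar mxE mulr_natl. Qed.

Lemma pd_covariant_conformal f u i j k : f u != 0 -> dif f u ->
  pd i (fun v => covariant (conformal f) v j k) u = - (j == k)%:R * (pd i f u / f u ^+ 2).
Proof.
move=> f0 df; under eq_fun do rewrite covariant_conformal.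
have [dV pV] := calculusV calculus f0 df.
by have [_ ->] := calculusZ (j == k)%:R dV; rewrite pV; ring.
Qed.

(** Where f vanishes both sides are 0, because 0^-1 = 0; thus the formula holds
   in a whole neighbourhood and may be differentiated. *)
Lemma christoffel_conformal f u i j k : dif f u ->
  christoffel pd (conformal f) i j k u =
  - 2%:R^-1 * ((i == k)%:R * (pd j f u / f u) + (i == j)%:R * (pd k f u / f u)
               - (j == k)%:R * (pd i f u / f u)).
Proof.
move=> df; rewrite /christoffel.
have [f0|f0] := eqVneq (f u) 0.
  rewrite big_ord2 /conformal !mxE f0.
  by rewrite !mul0rn !mul0r addr0 invr0 !mulr0 subr0 addr0 !mulr0.
under eq_bigr do rewrite !pd_covariant_conformal// /conformal mxE.
rewrite (bigD1 i)//= eqxx big1 => [|s si]; last first.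
  by rewrite eq_sym (negbTE si) mul0r.
by rewrite mulr1n addr0 (eq_sym j i); move: (2%:R^-1) => h; field.
Qed.

(** Raising the index cancels the division by f: the symbols become linear in f,
   which is why all the pencils below are almost compatible. *)
Lemma gamma_up_conformal f u i j k : f u != 0 -> dif f u ->
  gamma_up pd (conformal f) i j k u =
  - 2%:R^-1 * ((j == k)%:R * pd i f u + (j == i)%:R * pd k f u - (i == k)%:R * pd j f u).
Proof.
move=> f0 df; rewrite /gamma_up (bigD1 i)//= big1 => [|s si]; last first.
  by rewrite /conformal mxE eq_sym (negbTE si) mul0r.
rewrite christoffel_conformal// /conformal mxE eqxx mulr1n addr0.
by move: (2%:R^-1) => h; field.
Qed.

Section Curvature.
Variables (D : set 'rV[R]_2) (f : scalar) (u : 'rV[R]_2).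
Hypotheses (oD : open D) (Du : D u) (f0 : f u != 0).
Hypothesis df : forall v, D v -> dif f v /\ forall i, dif (pd i f) v.
Hypothesis two0 : 2%:R != 0 :> K.
Hypothesis sym : pd 0 (pd 1 f) u = pd 1 (pd 0 f) u.

Lemma pd_logarithmic_derivative i j :
  dif (fun v => pd i f v / f v) u /\
  pd j (fun v => pd i f v / f v) u =
    pd j (pd i f) u / f u - pd i f u * pd j f u / f u ^+ 2.
Proof.
have [dfu d2] := df Du.
have [dV pV] := calculusV calculus f0 dfu.
have [d p] := calculusM calculus (d2 i) dV.
by split=> //; rewrite p pV; field.
Qed.

Lemma pd_christoffel_conformal i j k l :
  pd l (christoffel pd (conformal f) i j k) u =
  - 2%:R^-1 *
   ((i == k)%:R * (pd l (pd j f) u / f u - pd j f u * pd l f u / f u ^+ 2)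
    + (i == j)%:R * (pd l (pd k f) u / f u - pd k f u * pd l f u / f u ^+ 2)
    - (j == k)%:R * (pd l (pd i f) u / f u - pd i f u * pd l f u / f u ^+ 2)).
Proof.
pose q i v := pd i f v / f v.
have hq i' : dif (q i') u by case: (pd_logarithmic_derivative i' l).
have hqp i' := (pd_logarithmic_derivative i' l).2.
have [d1 p1] := calculusZ (i == k)%:R (hq j).
have [d2 p2] := calculusZ (i == j)%:R (hq k).
have [d3 p3] := calculusZ (- (j == k)%:R) (hq i).
have [d4 p4] := calculusD calculus d1 d2.
have [d5 p5] := calculusD calculus d4 d3.
have [d6 p6] := calculusZ (- 2%:R^-1) d5.
have nE : \forall v \near u, (fun v => - 2%:R^-1 *
    ((i == k)%:R * q j v + (i == j)%:R * q k v + - (j == k)%:R * q i v)) v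
    = christoffel pd (conformal f) i j k v.
  apply: near_open oD Du _ => v Dv.
  rewrite christoffel_conformal; last by case: (df Dv).
  by congr (_ * (_ + _)); exact: mulNr.
have [_ <-] := calculus_near calculus nE d6.
rewrite p6 p5 p4 p1 p2 p3 /q !hqp.
by congr (_ * (_ + _)); exact: mulNr.
Qed.

(** The curvature of a surface has a single component, the Gaussian curvature,
   which for f I is f / 2 times the Laplacian of log f. *)
Lemma riemann_up_conformal i j k l :
  riemann_up pd (conformal f) i j k l u =
  ((i == k)%:R * (j == l)%:R - (i == l)%:R * (j == k)%:R) *
  (2%:R^-1 * (pd 0 (pd 0 f) u + pd 1 (pd 1 f) u
              - (pd 0 f u ^+ 2 + pd 1 f u ^+ 2) / f u)).
Proof.
have [dfu _] := df Du.
rewrite /riemann_up (bigD1 i)//= big1 => [|s si]; last first.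
  by rewrite /conformal mxE eq_sym (negbTE si) mul0r.
rewrite /riemann !big_ord2 !pd_christoffel_conformal !christoffel_conformal//.
rewrite /conformal mxE eqxx mulr1n addr0.
have := @conformal_curvature_identity K (f u) (fun i => pd i f u)
  (fun i j => pd i (pd j f) u) i j k l two0 f0 sym.
exact.
Qed.
End Curvature.

Section Pencil.
Variables (D : set 'rV[R]_2) (a E : scalar).
Hypothesis two0 : 2%:R != 0 :> K.
Hypothesis oD : open D.
Hypothesis da : forall u, D u -> dif a u /\ forall i, dif (pd i a) u.
Hypothesis sym : forall u, D u -> pd 0 (pd 1 a) u = pd 1 (pd 0 a) u.
Hypothesis harm : forall u, D u -> \sum_i pd i (pd i a) u = 0.
Hypothesis dE : forall u, D u -> dif E u /\ forall i, pd i E u = E u * pd i a u.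
Hypothesis E0 : forall u, D u -> E u != 0.

Local Notation g1 := (fun u => (E u)%:M : 'M[K]_2).
Local Notation g2 := (fun _ : 'rV[R]_2 => 1%:M : 'M[K]_2).
Local Notation F l1 l2 := (fun u => l1 * E u + l2).

Let pencilE l1 l2 : pencil l1 l2 g1 g2 = conformal (F l1 l2).
Proof.
apply/funext => u; rewrite /pencil /conformal !scale_scalar_mx mulr1.
by rewrite -raddfD.
Qed.

Let det_conformal f u : \det (conformal f u) != 0 -> f u != 0.
Proof. by rewrite det_scalar expf_eq0. Qed.

Let dF l1 l2 u : D u ->
  dif (F l1 l2) u /\ forall i, pd i (F l1 l2) u = l1 * E u * pd i a u.
Proof.
move=> Du; have [dEu pE] := dE Du.
have [d p] := calculusZ l1 dEu.
have [dc pc] := calculus_cst calculus l2 u.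
have [d' p'] := calculusD calculus d dc.
by split=> // i; rewrite p' p pc pE addr0 mulrA.
Qed.

Let d2F l1 l2 u i : D u -> dif (pd i (F l1 l2)) u /\
  forall j, pd j (pd i (F l1 l2)) u =
    l1 * E u * (pd j (pd i a) u + pd j a u * pd i a u).
Proof.
move=> Du; have [dEu pE] := dE Du; have [_ d2a] := da Du.
have [d1 p1] := calculusZ l1 dEu.
have [d2 p2] := calculusM calculus d1 (d2a i).
have nE : \forall v \near u, (fun v => l1 * E v * pd i a v) v = pd i (F l1 l2) v.
  by apply: near_open oD Du _ => v Dv; rewrite (dF l1 l2 Dv).2.
have [d p] := calculus_near calculus nE d2.
by split=> // j; rewrite -p p2 p1 pE; ring.
Qed.

(* For F = l1 E + l2 with log E harmonic, the Gaussian curvature is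
   l1 l2 E (a_1 ^ 2 + a_2 ^ 2) / (2 F): it vanishes for l1 = 0 and for l2 = 0. *)
Let riemann_F l1 l2 u i j k l : D u -> F l1 l2 u != 0 ->
  riemann_up pd (conformal (F l1 l2)) i j k l u =
  ((i == k)%:R * (j == l)%:R - (i == l)%:R * (j == k)%:R) *
  (2%:R^-1 * l1 * l2 * E u * (pd 0 a u ^+ 2 + pd 1 a u ^+ 2) / F l1 l2 u).
Proof.
move=> Du f0.
rewrite (@riemann_up_conformal D)//; first last.
- by rewrite !(d2F _ _ _ Du).2 (sym Du) [pd 0 a u * _]mulrC.
- move=> v Dv; split=> [|i']; first by case: (dF l1 l2 Dv).
  by case: (d2F l1 l2 i' Dv).
congr (_ * _); rewrite !(d2F _ _ _ Du).2 !(dF _ _ Du).2.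
have := harm Du; rewrite big_ord2 => /eqP; rewrite addr_eq0 => /eqP ->.
move: (pd 1 (pd 1 a) u) (pd 0 a u) (pd 1 a u) (E u) f0 => p q r e f0.
by field; rewrite two0 f0.
Qed.

Let g1E : g1 = conformal (F 1 0).
Proof. by apply/funext => u; rewrite /conformal mul1r addr0. Qed.
Let g2E : g2 = conformal (F 0 1).
Proof. by apply/funext => u; rewrite /conformal mul0r add0r. Qed.
Let g1_neq0 u : D u -> F 1 0 u != 0.
Proof. by move=> Du; rewrite /= mul1r addr0 E0. Qed.
Let g2_neq0 u : F 0 1 u != 0.
Proof. by rewrite /= mul0r add0r oner_eq0. Qed.

Lemma conformal_pencil_almost_compatible : almost_compatible pd D g1 g2.
Proof.
move=> l1 l2 _ u Du; rewrite pencilE => /det_conformal f0 i j k.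
have difF m1 m2 : dif (F m1 m2) u by case: (dF m1 m2 Du).
have n1 := g1_neq0 Du; have n2 := g2_neq0 u.
by rewrite g1E g2E !gamma_up_conformal// !(dF _ _ Du).2; ring.
Qed.

Lemma conformal_pencil_compatible : compatible pd D g1 g2 <->
  forall u, D u -> pd 0 a u ^+ 2 + pd 1 a u ^+ 2 = 0.
Proof.
split=> [[_ comp] u Du|N0]; last first.
  split; first exact: conformal_pencil_almost_compatible.
  move=> l1 l2 _ u Du; rewrite pencilE => /det_conformal f0 i j k l.
  have n1 := g1_neq0 Du; have n2 := g2_neq0 u.
  by rewrite g1E g2E !riemann_F// N0//; ring.
(* E u + 1 and E u + 2 cannot both vanish, so l1 = 1 and l2 = 1 or 2 give a
   pencil that is nondegenerate at u and sees the curvature. *)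
have [l2 l20 f0] : exists2 l2, l2 != 0 & F 1 l2 u != 0.
  have [e1|] := eqVneq (E u + 1) 0; last by exists 1; rewrite /= ?oner_eq0 ?mul1r.
  exists 2%:R => //=; rewrite mul1r (_ : 2%:R = 1 + 1) // addrA e1 add0r.
  exact: oner_neq0.
have df : \det (pencil 1 l2 g1 g2 u) != 0.
  by rewrite pencilE det_scalar expf_eq0.
have := comp 1 l2 (ex_intro2 _ _ u Du df) u Du df 0 1 0 1.
have n1 := g1_neq0 Du; have n2 := g2_neq0 u.
rewrite pencilE g1E g2E !riemann_F//.
rewrite !mulr0 !mul0r !mulr0 addr0 /= mulr1 mul1r subr0 mul1r => /eqP.
rewrite !mulf_eq0 !invr_eq0 (negbTE two0) (negbTE l20) (negbTE (E0 Du)) oner_eq0.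
by rewrite -[E u]mul1r (negbTE f0) !orbF => /eqP.
Qed.

End Pencil.
End ConformalGeometry.

(** * Closure properties of C1 and C2 functions *)

Section PlaneSmoothness.
Variable R : realType.
Implicit Types (f g : 'rV[R]_2 -> R) (u v : 'rV[R]_2) (D : set 'rV[R]_2).

Lemma C1_of_pderiv D f (df : 'I_2 -> 'rV[R]_2 -> R) : open D ->
  (forall u i, D u -> derivable f u 'e_i /\ pderiv i f u = df i u) ->
  (forall u i, D u -> {for u, continuous (df i)}) -> C1 D f.
Proof.
move=> oD hf cf u Du i; have [d e] := hf u i Du; split=> //.
rewrite /prop_for /continuous_at e; apply: cvg_trans (cf u i Du).
have nE : \forall v \near u, df i v = pderiv i f v.
  by apply: near_open oD Du _ => v Dv; case: (hf v i Dv).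
exact: (near_eq_cvg nE).
Qed.

Lemma C1D D f g : open D -> C1 D f -> C1 D g -> C1 D (fun u => f u + g u).
Proof.
move=> oD df dg.
apply: (@C1_of_pderiv _ _ (fun i u => pderiv i f u + pderiv i g u)) => // u i Du.
  have d1 := C1_derivable (i := i) df Du; have d2 := C1_derivable (i := i) dg Du.
  by split; [exact: (derivableD d1 d2)|exact: pderivD].
by apply: continuousD; [exact: (df u Du i).2|exact: (dg u Du i).2].
Qed.

Lemma C1N D f : open D -> C1 D f -> C1 D (fun u => - f u).
Proof.
move=> oD df.
apply: (@C1_of_pderiv _ _ (fun i u => - pderiv i f u)) => // u i Du.
  have d1 := C1_derivable (i := i) df Du.
  by split; [exact: derivableN|exact: pderivN].
by apply: continuousN; exact: (df u Du i).2.
Qed.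

Lemma C1M D f g : open D -> C1 D f -> C1 D g -> C1 D (fun u => f u * g u).
Proof.
move=> oD df dg.
apply: (@C1_of_pderiv _ _ (fun i u => f u * pderiv i g u + pderiv i f u * g u)) => // u i Du.
  have d1 := C1_derivable (i := i) df Du; have d2 := C1_derivable (i := i) dg Du.
  by split; [exact: (derivableM d1 d2)|exact: pderivM].
apply: continuousD; apply: continuousM.
- exact: C1_continuous oD df Du.
- exact: (dg u Du i).2.
- exact: (df u Du i).2.
- exact: C1_continuous oD dg Du.
Qed.

Lemma pderiv_comp (phi dphi : R -> R) f u i :
  (forall t, is_derive t (1 : R) phi (dphi t)) -> derivable f u 'e_i ->
  derivable (fun v => phi (f v)) u 'e_i /\
  pderiv i (fun v => phi (f v)) u = dphi (f u) * pderiv i f u.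
Proof. by move=> hphi df; have [] := is_derive_comp_dir hphi df. Qed.

Lemma C1_comp D (phi dphi : R -> R) f : open D ->
  (forall t, is_derive t (1 : R) phi (dphi t)) -> continuous dphi ->
  C1 D f -> C1 D (fun u => phi (f u)).
Proof.
move=> oD hphi cphi df.
apply: (@C1_of_pderiv _ _ (fun i u => dphi (f u) * pderiv i f u)) => // u i Du.
  exact: pderiv_comp hphi (C1_derivable (i := i) df Du).
apply: continuousM; last exact: (df u Du i).2.
by apply: continuous_comp; [exact: C1_continuous oD df Du|exact: cphi].
Qed.

Lemma C2_cst D (c : R) : open D -> C2 D (fun=> c).
Proof.
move=> oD; split=> [|i]; first exact: C1_cst.
by apply: C1_eq oD _ (@C1_cst R 2 D 0) => u _; rewrite pderiv_cst.
Qed.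

Lemma C2N D f : open D -> C2 D f -> C2 D (fun u => - f u).
Proof.
move=> oD [df d2f]; split=> [|i]; first exact: C1N.
apply: C1_eq oD _ (C1N oD (d2f i)) => u Du.
by rewrite pderivN//; exact: C1_derivable df Du.
Qed.

Lemma C2M D f g : open D -> C2 D f -> C2 D g -> C2 D (fun u => f u * g u).
Proof.
move=> oD [df d2f] [dg d2g]; split=> [|i]; first exact: C1M.
apply: C1_eq oD _ (C1D oD (C1M oD df (d2g i)) (C1M oD (d2f i) dg)) => u Du.
by rewrite pderivM//; [exact: C1_derivable df Du|exact: C1_derivable dg Du].
Qed.

Lemma C2_comp D (phi dphi d2phi : R -> R) f : open D ->
  (forall t, is_derive t (1 : R) phi (dphi t)) ->
  (forall t, is_derive t (1 : R) dphi (d2phi t)) -> continuous d2phi ->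
  C2 D f -> C2 D (fun u => phi (f u)).
Proof.
move=> oD hphi hdphi cd2 [df d2f].
have cd : continuous dphi.
  move=> t; apply/differentiable_continuous/derivable1_diffP.
  by have [] := hdphi t.
split=> [|i]; first exact: C1_comp hphi cd df.
apply: C1_eq oD _ (C1M oD (C1_comp oD hdphi cd2 df) (d2f i)) => u Du.
by have [_ ->] := pderiv_comp hphi (C1_derivable (i := i) df Du).
Qed.

Lemma C2_expR D f : open D -> C2 D f -> C2 D (fun u => expR (f u)).
Proof.
by move=> oD; apply: (@C2_comp D expR expR expR) => //; exact: continuous_expR.
Qed.

Lemma C2_cos D f : open D -> C2 D f -> C2 D (fun u => cos (f u)).
Proof.
move=> oD; apply: (@C2_comp D cos (fun t => - sin t) (fun t => - cos t)) => // t.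
by apply: continuousN; exact: continuous_cos.
Qed.

Lemma C2_sin D f : open D -> C2 D f -> C2 D (fun u => sin (f u)).
Proof.
move=> oD; apply: (@C2_comp D sin cos (fun t => - sin t)) => //.
by move=> t; apply: continuousN; exact: continuous_sin.
Qed.

End PlaneSmoothness.

(** * The real and the complex differential calculus *)

Section RealCalculus.
Variable R : realType.
Implicit Types (f g : 'rV[R]_2 -> R) (u v : 'rV[R]_2).

(** Partial differentiability at u, in the coordinate directions only. *)
Definition differentiable_at f u : Prop := forall i, derivable f u 'e_i.

Lemma real_calculus : differential_calculus (@pderiv R 2) differentiable_at.
Proof.
split.
- move=> f g u fg df; split=> i; first exact: near_eq_derivable fg (df i).
  exact: pderiv_near.
- by move=> c u; split=> i; [exact: derivable_cst|exact: pderiv_cst].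
- by move=> f g u df dg; split=> i; [exact: derivableD|exact: pderivD].
- by move=> f g u df dg; split=> i; [exact: derivableM|exact: pderivM].
- by move=> f u f0 df; split=> i; [exact: derivableV|exact: pderivV].
Qed.

End RealCalculus.

Section ComplexCalculus.
Variable R : realType.
Implicit Types (f g : 'rV[R]_2 -> R[i]) (u v : 'rV[R]_2).

Definition cdifferentiable_at f u : Prop :=
  differentiable_at (fun v => complex.Re (f v)) u /\
  differentiable_at (fun v => complex.Im (f v)) u.

Lemma complex_calculus : differential_calculus (@cpderiv R 2) cdifferentiable_at.
Proof.
have rc := real_calculus R.
split.
- move=> f g u fg [dr di].
  have nr : \forall v \near u, complex.Re (f v) = complex.Re (g v).
    by apply: filterS fg => v ->.
  have ni : \forall v \near u, complex.Im (f v) = complex.Im (g v).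
    by apply: filterS fg => v ->.
  have [dr' pr] := calculus_near rc nr dr; have [di' pi] := calculus_near rc ni di.
  by split=> [|i]; [split|rewrite /cpderiv pr pi].
- move=> c u; have [d1 p1] := calculus_cst rc (complex.Re c) u.
  have [d2 p2] := calculus_cst rc (complex.Im c) u.
  by split=> [|i]; [split|rewrite /cpderiv p1 p2].
- move=> f g u [fr fi] [gr gi].
  have [d1 p1] := calculusD rc fr gr; have [d2 p2] := calculusD rc fi gi.
  have er : (fun v => complex.Re (f v + g v)) = (fun v => complex.Re (f v) + complex.Re (g v)).
    by apply/funext => v; rewrite raddfD.
  have ei : (fun v => complex.Im (f v + g v)) = (fun v => complex.Im (f v) + complex.Im (g v)).
    by apply/funext => v; rewrite raddfD.
  rewrite /cdifferentiable_at er ei; split=> [|i]; first by split.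
  by rewrite /cpderiv er ei p1 p2.
- move=> f g u [fr fi] [gr gi].
  have er : (fun v => complex.Re (f v * g v)) =
      (fun v => complex.Re (f v) * complex.Re (g v) + - 1 * (complex.Im (f v) * complex.Im (g v))).
    by apply/funext => v; case: (f v) (g v) => [a b] [c d] /=; ring.
  have ei : (fun v => complex.Im (f v * g v)) =
      (fun v => complex.Re (f v) * complex.Im (g v) + complex.Im (f v) * complex.Re (g v)).
    by apply/funext => v; case: (f v) (g v) => [a b] [c d] /=; ring.
  have [d1 p1] := calculusM rc fr gr; have [d2 p2] := calculusM rc fi gi.
  have [d3 p3] := calculusM rc fr gi; have [d4 p4] := calculusM rc fi gr.
  have [d5 p5] := calculusZ rc (- 1) d2.
  have [d6 p6] := calculusD rc d1 d5; have [d7 p7] := calculusD rc d3 d4.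
  rewrite /cdifferentiable_at er ei; split=> [|i]; first by split.
  rewrite /cpderiv er ei p6 p7 p5 p1 p2 p3 p4.
  move: (pderiv _ _ _) (pderiv _ _ _) (pderiv _ _ _) (pderiv _ _ _) => w x y z.
  by case: (f u) (g u) => [a b] [c d] /=; congr (_ +i* _) => /=; ring.
- move=> f u f0 [fr fi].
  pose n v := complex.Re (f v) ^+ 2 + complex.Im (f v) ^+ 2.
  have er : (fun v => complex.Re (f v)^-1) = (fun v => complex.Re (f v) * (n v)^-1).
    by apply/funext => v; rewrite /n; case: (f v).
  have ei : (fun v => complex.Im (f v)^-1) = (fun v => - 1 * (complex.Im (f v) * (n v)^-1)).
    by apply/funext => v; rewrite /n; case: (f v) => a b /=; ring.
  have n0 : n u != 0.
    apply: contra f0; rewrite /n; case: (f u) => a b /=.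
    by rewrite paddr_eq0 ?sqr_ge0// !sqrf_eq0 => /andP[/eqP-> /eqP->].
  have [d1 p1] := calculusM rc fr fr; have [d2 p2] := calculusM rc fi fi.
  have [d3 p3] := calculusD rc d1 d2.
  have [d4 p4] := calculusV rc n0 d3.
  have [d5 p5] := calculusM rc fr d4; have [d6 p6] := calculusM rc fi d4.
  have [d7 p7] := calculusZ rc (- 1) d6.
  rewrite /cdifferentiable_at er ei; split=> [|i]; first by split.
  rewrite /cpderiv er ei p5 p7 p6 p4 p3 p1 p2.
  move: n0; rewrite /n.
  move: (pderiv _ _ _) (pderiv _ _ _) => x y.
  case: (f u) => [a b] /= n0.
  have -> : - (a +i* b) ^- 2 = - ((a / (a ^+ 2 + b ^+ 2)) -i* (b / (a ^+ 2 + b ^+ 2))) ^+ 2.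
    by rewrite -exprVn.
  rewrite [RHS]/= ; congr (_ +i* _); simpl; field; exact: n0.
Qed.

End ComplexCalculus.

(** * The isotropy equation for harmonic functions *)

Section HarmonicGradient.
Variable R : realType.
Implicit Types (f g : 'rV[R]_2 -> R) (u v : 'rV[R]_2) (D : set 'rV[R]_2).

Lemma harmonicN D f : harmonic_on (@pderiv R 2) (C2 D) D f -> open D ->
  harmonic_on (@pderiv R 2) (C2 D) D (fun u => - f u).
Proof.
move=> [c2 h] oD; split; first exact: C2N.
move=> u Du; have E i : pderiv i (pderiv i (fun v => - f v)) u = - pderiv i (pderiv i f) u.
  rewrite (@pderiv_near _ _ _ (fun v => - pderiv i f v)).
    by rewrite pderivN//; exact: C1_derivable (c2.2 i) Du.
  by apply: near_open oD Du _ => v Dv; rewrite pderivN//; exact: C1_derivable c2.1 Dv.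
by rewrite (eq_bigr _ (fun i _ => E i)) sumrN h// oppr0.
Qed.

(** The two functions are the real and imaginary parts of a_1 - i a_2 for
   a = f + i g, which is twice the derivative of a with respect to
   u^1 + i u^2. *)
Lemma harmonic_cauchy_riemann D f g : open D ->
  harmonic_on (@pderiv R 2) (C2 D) D f -> harmonic_on (@pderiv R 2) (C2 D) D g ->
  cauchy_riemann D (fun u => pderiv 0 f u + pderiv 1 g u)
                   (fun u => pderiv 0 g u - pderiv 1 f u).
Proof.
move=> oD [cf hf] [cg hg].
have lap h u : \sum_i pderiv i (pderiv i h) u = 0 ->
    pderiv 1 (pderiv 1 h) u = - pderiv 0 (pderiv 0 h) u.
  by rewrite big_ord2 addrC => /eqP; rewrite addr_eq0 => /eqP.
have d h i j u : C2 D h -> D u -> derivable (pderiv i h) u 'e_j.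
  by move=> ch Du; exact: C1_derivable (ch.2 i) Du.
split.
- by apply: C1D => //; [exact: cf.2|exact: cg.2].
- by apply: C1D => //; [exact: cg.2|apply: C1N => //; exact: cf.2].
- move=> u Du; rewrite (pderivD (d f 0 0 u cf Du) (d g 1 0 u cg Du)).
  have n : derivable (fun v => - pderiv 1 f v) u 'e_1 by exact: derivableN (d f 1 1 u cf Du).
  rewrite (pderivD (d g 0 1 u cg Du) n) (pderivN (d f 1 1 u cf Du)).
  rewrite (lap f u (hf u Du)) (schwarz 0 1 oD cg Du).
  by move: (pderiv _ _ _) (pderiv _ _ _) => x y; rewrite opprK addrC.
- move=> u Du; rewrite (pderivD (d f 0 1 u cf Du) (d g 1 1 u cg Du)).
  have n : derivable (fun v => - pderiv 1 f v) u 'e_0 by exact: derivableN (d f 1 0 u cf Du).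
  rewrite (pderivD (d g 0 0 u cg Du) n) (pderivN (d f 1 0 u cf Du)).
  rewrite (lap g u (hg u Du)) (schwarz 0 1 oD cf Du).
  by move: (pderiv _ _ _) (pderiv _ _ _) => x y; rewrite opprB.
Qed.

(** The equation factors as (a_1 - i a_2) (a_1 + i a_2) = 0 for a = f + i g.  The
   first factor is holomorphic, and so is the conjugate of the second, being the
   first factor for f - i g.  Where the first does not vanish the second does,
   hence it vanishes identically by unique continuation. *)
Lemma harmonic_gradient_dichotomy D f g : is_domain D ->
  harmonic_on (@pderiv R 2) (C2 D) D f -> harmonic_on (@pderiv R 2) (C2 D) D g ->
  (forall u, D u -> (pderiv 0 f u +i* pderiv 0 g u) ^+ 2 +
                    (pderiv 1 f u +i* pderiv 1 g u) ^+ 2 = 0) ->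
  (forall u, D u -> pderiv 1 f u = - pderiv 0 g u /\ pderiv 1 g u = pderiv 0 f u) \/
  (forall u, D u -> pderiv 1 f u = pderiv 0 g u /\ pderiv 1 g u = - pderiv 0 f u).
Proof.
move=> domD hf hg N0; have [_ oD _] := domD.
have crp := harmonic_cauchy_riemann oD hf hg.
have crq := harmonic_cauchy_riemann oD hf (harmonicN hg oD).
set U := (fun u => _ + _) in crp; set V := (fun u => _ - _) in crp.
have dg i u : D u -> pderiv i (fun v => - g v) u = - pderiv i g u.
  by move=> Du; rewrite pderivN//; exact: C1_derivable hg.1.1 Du.
have prod u : D u -> U u = 0 /\ V u = 0 \/
    (pderiv 0 f u = pderiv 1 g u /\ pderiv 0 g u = - pderiv 1 f u).
  move=> Du; have := N0 u Du; rewrite /U /V.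
  move: (pderiv 0 f u) (pderiv 0 g u) (pderiv 1 f u) (pderiv 1 g u) => a b c d e.
  have : ((a + d) +i* (b - c)) * ((a - d) +i* (b + c)) = 0.
    rewrite -[RHS]e !expr2; congr (_ +i* _) => /=; ring.
  move/eqP; rewrite mulf_eq0 => /orP[/eqP[h1 h2]|/eqP[/eqP + /eqP]]; first by left.
  by rewrite subr_eq0 addr_eq0 => /eqP h1 /eqP h2; right.
have [p0|/existsNP[u0 /not_implyP[Du0 p0]]] :=
    pselect (forall u, D u -> U u = 0 /\ V u = 0).
  right=> u /p0[]; rewrite /U /V => /eqP + /eqP.
  by rewrite addr_eq0 subr_eq0 => /eqP -> /eqP ->; rewrite opprK.
left.
have np : \forall v \near u0, ~ (U v = 0 /\ V v = 0).
  have [cU cV _ _] := crp.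
  have [Un0|Un0] := eqVneq (U u0) 0.
    have Vn0 : V u0 != 0 by apply/eqP => V0; apply: p0.
    have nz : \forall v \near u0, V v != 0.
      exact: (cvgr_neq0 (F := nbhs u0) (V u0) (C1_continuous oD cV Du0) Vn0).
    by apply: filterS nz => v /eqP + [_].
  have nz : \forall v \near u0, U v != 0.
    exact: (cvgr_neq0 (F := nbhs u0) (U u0) (C1_continuous oD cU Du0) Un0).
  by apply: filterS nz => v /eqP + [].
have nq : \forall v \near u0,
   pderiv 0 f v + pderiv 1 (fun v => - g v) v = 0 /\
   pderiv 0 (fun v => - g v) v - pderiv 1 f v = 0.
  have nD : nbhs u0 D by exact: open_nbhs_nbhs.
  apply: filterS (filterI nD np) => v [Dv nv].
  by have [//|[h1 h2]] := prod v Dv; rewrite !dg// h1 h2 subrr opprK subrr.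
move=> u Du; have := cauchy_riemann_unique_continuation domD crq Du0 nq Du.
rewrite !dg// => -[/eqP + /eqP].
by rewrite !subr_eq0 => /eqP -> /eqP ->.
Qed.

End HarmonicGradient.

(** * The exponential metrics *)

Section ExponentialMetrics.
Variable R : realType.
Implicit Types (D : set 'rV[R]_2).

Lemma conformal_is_metric (K : fieldType) (reg : ('rV[R]_2 -> K) -> Prop) D
    (E : 'rV[R]_2 -> K) : reg E -> reg (fun=> 0) -> (forall u, D u -> E u != 0) ->
  is_metric reg D (fun u => (E u)%:M).
Proof.
move=> rE r0 E0; split=> [i j|u Du]; last first.
  by rewrite tr_scalar_mx det_scalar expf_neq0// E0.
have -> : (fun u => (E u)%:M i j) = if i == j then E else fun=> 0.
  by apply/funext => u; rewrite mxE; case: (i == j).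
by case: ifP.
Qed.

Lemma real_complexM (p q r : R) : p%:C * (q +i* r) = (p * q) +i* (p * r).
Proof. by congr (_ +i* _) => /=; ring. Qed.

Lemma Re_cexp (a : 'rV[R]_2 -> R[i]) : (fun v => complex.Re (cexp (a v))) =
  (fun v => expR (complex.Re (a v)) * cos (complex.Im (a v))).
Proof. by apply/funext => v; rewrite /cexp real_complexM. Qed.

Lemma Im_cexp (a : 'rV[R]_2 -> R[i]) : (fun v => complex.Im (cexp (a v))) =
  (fun v => expR (complex.Re (a v)) * sin (complex.Im (a v))).
Proof. by apply/funext => v; rewrite /cexp real_complexM. Qed.

Lemma cexp_neq0 (z : R[i]) : cexp z != 0.
Proof.
case: z => x y; rewrite /cexp mulf_neq0//.
  by rewrite (inj_eq (@complexI R)) gt_eqF// expR_gt0.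
apply/eqP => -[c s]; have := cos2Dsin2 y.
by rewrite c s expr0n addr0 => /eqP; rewrite eq_sym oner_eq0.
Qed.

Lemma C2_cexp D (a : 'rV[R]_2 -> R[i]) : open D -> cC2 D a -> cC2 D (fun u => cexp (a u)).
Proof.
move=> oD [cr ci]; rewrite /cC2 Re_cexp Im_cexp; split.
  exact: C2M oD (C2_expR oD cr) (C2_cos oD ci).
exact: C2M oD (C2_expR oD cr) (C2_sin oD ci).
Qed.

Lemma cpderiv_cexp (a : 'rV[R]_2 -> R[i]) u : cdifferentiable_at a u ->
  cdifferentiable_at (fun v => cexp (a v)) u /\
  forall i, cpderiv i (fun v => cexp (a v)) u = cexp (a u) * cpderiv i a u.
Proof.
move=> [dr di]; have rc := real_calculus R.
have de i := pderiv_comp (@is_derive_expR R) (dr i).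
have dc i := pderiv_comp (@is_derive_cos R) (di i).
have ds i := pderiv_comp (@is_derive_sin R) (di i).
have [d1 p1] := calculusM rc (fun i => (de i).1) (fun i => (dc i).1).
have [d2 p2] := calculusM rc (fun i => (de i).1) (fun i => (ds i).1).
rewrite /cdifferentiable_at Re_cexp Im_cexp; split=> [|i]; first by split.
rewrite /cpderiv Re_cexp Im_cexp p1 p2 (de i).2 (dc i).2 (ds i).2 /cexp real_complexM.
move: (pderiv _ _ _) (pderiv _ _ _) => x y.
by congr (_ +i* _) => /=; ring.
Qed.

End ExponentialMetrics.

Theorem proposition6p1 (R : realType) (D : set 'rV[R]_2) (hD : is_domain D) :
  (forall a : 'rV[R]_2 -> R,
     harmonic_on (@pderiv R 2) (C2 D) D a -> nonconstant D a ->
     let g1 : 'rV[R]_2 -> 'M[R]_2 := fun u => (expR (a u))%:M in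
     let g2 : 'rV[R]_2 -> 'M[R]_2 := fun _ => 1%:M in
     [/\ is_metric (C2 D) D g1, is_metric (C2 D) D g2,
         almost_compatible (@pderiv R 2) D g1 g2 &
         ~ compatible (@pderiv R 2) D g1 g2]) /\
  (forall a : 'rV[R]_2 -> R[i],
     harmonic_on (@cpderiv R 2) (cC2 D) D a ->
     let g1 : 'rV[R]_2 -> 'M[R[i]]_2 := fun u => (cexp (a u))%:M in
     let g2 : 'rV[R]_2 -> 'M[R[i]]_2 := fun _ => 1%:M in
     [/\ is_metric (cC2 D) D g1, is_metric (cC2 D) D g2 &
         compatible (@cpderiv R 2) D g1 g2 <->
         function_of (@zcoord R) D a \/ function_of (@zbarcoord R) D a]).
Proof.
have [_ oD _] := hD.
split=> a [ca ha].
  move=> [x [y [Dx Dy axy]]] g1 g2.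
  have da u : D u -> differentiable_at a u /\ forall i, differentiable_at (pderiv i a) u.
    by move=> Du; split=> [i|i j]; [exact: C1_derivable ca.1 Du|exact: C1_derivable (ca.2 i) Du].
  have two0 : 2%:R != 0 :> R by rewrite pnatr_eq0.
  have E0 u : D u -> expR (a u) != 0 by move=> _; rewrite gt_eqF// expR_gt0.
  have dE u : D u -> differentiable_at (fun v => expR (a v)) u /\
      forall i, pderiv i (fun v => expR (a v)) u = expR (a u) * pderiv i a u.
    by move=> /da[d _]; split=> i; have [] := pderiv_comp (@is_derive_expR R) (d i).
  have rc := real_calculus R.
  split.
  - exact: conformal_is_metric (C2_expR oD ca) (C2_cst 0 oD) E0.
  - exact: conformal_is_metric (C2_cst 1 oD) (C2_cst 0 oD) (fun u _ => oner_neq0 R).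
  - exact: (@conformal_pencil_almost_compatible R R _ _ rc D a (fun u => expR (a u)) dE E0).
  - have sa u : D u -> pderiv 0 (pderiv 1 a) u = pderiv 1 (pderiv 0 a) u by exact: schwarz.
    move=> /(conformal_pencil_compatible rc two0 oD da sa ha dE E0) N0.
    apply: axy; apply: (gradient0_constant hD ca.1) => // u Du.
    have /eqP := N0 u Du; rewrite paddr_eq0 ?sqr_ge0// !sqrf_eq0 => /andP[/eqP g0 /eqP g1'].
    by elim/ord2_ind.
move=> g1 g2; have [cr ci] := ca.
have da u : D u -> cdifferentiable_at a u /\ forall i, cdifferentiable_at (cpderiv i a) u.
  move=> Du; split; first by split=> i; [exact: C1_derivable cr.1 Du|exact: C1_derivable ci.1 Du].
  by move=> i; split=> j; [exact: C1_derivable (cr.2 i) Du|exact: C1_derivable (ci.2 i) Du].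
have two0 : 2%:R != 0 :> R[i] by rewrite pnatr_eq0.
have E0 u : D u -> cexp (a u) != 0 by move=> _; exact: cexp_neq0.
have dE u (Du : D u) := cpderiv_cexp (da u Du).1.
have sa u : D u -> cpderiv 0 (cpderiv 1 a) u = cpderiv 1 (cpderiv 0 a) u.
  by move=> Du; exact: (f_equal2 (@Complex R) (schwarz 0 1 oD cr Du) (schwarz 0 1 oD ci Du)).
have c0 (c : R[i]) : cC2 D (fun=> c) by split; exact: C2_cst.
split.
- exact: conformal_is_metric (C2_cexp oD ca) (c0 0) E0.
- exact: conformal_is_metric (c0 1) (c0 0) (fun u _ => oner_neq0 R[i]).
have z1 : @zcoord R = signed_coord 1.
  by apply/funext => u; rewrite /signed_coord mul1r.
have z2 : @zbarcoord R = signed_coord (- 1).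
  by apply/funext => u; rewrite /signed_coord mulN1r.
rewrite z1 z2.
have CE := conformal_pencil_compatible (complex_calculus R) two0 oD da sa ha dE E0.
split=> [/CE N0|fo]; last first.
  apply/CE => u Du.
  have [s ss cra] : exists2 s : R, s * s = 1 & cpderiv 1 a u = s%:C * 'i * cpderiv 0 a u.
    by case: fo => fo; [exists 1|exists (- 1)]; rewrite ?mulrNN ?mulr1//;
       exact: function_of_cpderiv oD fo Du.
  have sE : s%:C ^+ 2 = 1 by rewrite -rmorphXn expr2 ss rmorph1.
  by rewrite cra !exprMn sE sqr_i mul1r mulN1r subrr.
have lap u (Du : D u) : cpderiv 0 (cpderiv 0 a) u + cpderiv 1 (cpderiv 1 a) u = 0.
  by rewrite -(ha u Du) big_ord2.
have hr : harmonic_on (@pderiv R 2) (C2 D) D (fun u => complex.Re (a u)).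
  by split=> // u Du; rewrite big_ord2; exact: (congr1 (@complex.Re R) (lap u Du)).
have hi : harmonic_on (@pderiv R 2) (C2 D) D (fun u => complex.Im (a u)).
  by split=> // u Du; rewrite big_ord2; exact: (congr1 (@complex.Im R) (lap u Du)).
have [h|h] := harmonic_gradient_dichotomy hD hr hi N0; [left|right];
  apply: cauchy_riemann_function_of oD _ cr.1 ci.1 _; rewrite ?mulrNN ?mulr1// => u Du;
  rewrite /cpderiv; have [-> ->] := h u Du;
  by move: (pderiv _ _ _) (pderiv _ _ _) => p q; congr (_ +i* _) => /=; ring.
Qed.
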